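(* Let $\phi=\tilde p/p$ satisfy (A1). Then there is an open set $E_0\subseteq\mathbb{T}^2$ containing $(1,1)$ so that for $1\le\mathfrak p<\infty$ and all open sets $E\subseteq E_0$ containing $(1,1)$, $$\iint_E\left|\tfrac{\partial\phi}{\partial z_1}(\zeta_1,\zeta_2)\right|^{\mathfrak p}|d\zeta_1||d\zeta_2|<\infty\quad\text{if and only if}\quad\iint_E\left|\tfrac{\partial\phi}{\partial z_2}(\zeta_1,\zeta_2)\right|^{\mathfrak p}|d\zeta_1||d\zeta_2|<\infty.$$
   Context: $\mathbb{D}$ is the open unit disk and $\mathbb{T}$ the unit circle; $|d\zeta|$ is Lebesgue (arc length) measure on $\mathbb{T}$. For a polynomial $p\in\mathbb{C}[z_1,z_2]$ of bidegree $(m,n)$, its reflection is $\tilde p(z_1,z_2)=z_1^mz_2^n\overline{p(1/\bar z_1,1/\bar z_2)}$. A rational inner function (RIF) on $\mathbb{D}^2$ is a rational function that is holomorphic and bounded on $\mathbb{D}^2$ with $|\phi|=1$ a.e. on $\mathbb{T}^2$. (A1): $\phi=\tilde p/p$ is an RIF on $\mathbb{D}^2$, where $p$ has no zeros in $\mathbb{D}^2$ and $p,\tilde p$ have no common factor; $\phi$ has a singularity at $(1,1)$ (i.e. $p(1,1)=0$, hence also $\tilde p(1,1)=0$); and the non-tangential value of $\phi$ at $(1,1)$ is $1$, i.e. $\phi(z_k)\to1$ whenever $z_k\in\mathbb{D}^2$ approaches $(1,1)$ non-tangentially. *)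

(* Defs.v *)
From mathcomp Require Import all_boot all_order all_algebra.
From mathcomp Require Import polyXY complex ring.
From mathcomp Require Import all_classical all_reals all_analysis.

Set Implicit Arguments.
Unset Strict Implicit.
Unset Printing Implicit Defensive.

Import Order.TTheory GRing.Theory Num.Theory numFieldNormedType.Exports.

Local Open Scope classical_set_scope.
Local Open Scope ring_scope.

(* [R[i]] with the topology of its modulus, read off its numFieldType
   structure; derivatives of functions on [C R] are complex derivatives. *)
Definition C (R : realType) : numClosedFieldType := R[i].

Definition cmod (R : realType) (z : C R) : R := complex.Re `|z|.

Definition expi (R : realType) (t : R) : C R := (cos t +i* sin t)%C.

Definition bidisk (R : realType) : set (C R * C R) :=
  [set z | cmod z.1 < 1 /\ cmod z.2 < 1].
Arguments bidisk : clear implicits.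

Definition torus (R : realType) : set (C R * C R) :=
  [set z | cmod z.1 = 1 /\ cmod z.2 = 1].
Arguments torus : clear implicits.

Definition torus_open (R : realType) (E : set (C R * C R)) : Prop :=
  exists2 U : set (C R * C R), open U & E = U `&` torus R.

(** Arc length on the circle is Lebesgue measure in the angle. *)

Definition angles (R : realType) : set (R * R) :=
  `](- pi), pi]%classic `*` `](- pi), pi]%classic.
Arguments angles : clear implicits.

Definition torus_point (R : realType) (t : R * R) : C R * C R :=
  (expi t.1, expi t.2).

Definition angle_measure (R : realType) :
    {measure set (measurableTypeR R * measurableTypeR R) -> \bar R} :=
  (@lebesgue_measure R \x @lebesgue_measure R)%E.
Arguments angle_measure : clear implicits.

Definition torus_integral (R : realType) (E : set (C R * C R))
    (F : C R * C R -> R) : \bar R :=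
  (\int[angle_measure R]_(t in angles R `&` (@torus_point R @^-1` E))
     (F (torus_point t))%:E)%E.

Definition torus_ae (R : realType) (P : C R * C R -> Prop) : Prop :=
  {ae angle_measure R, forall t, angles R t -> P (torus_point t)}.

(** A polynomial in [C[z1, z2]] is a [p : {poly {poly C}}], with ['X] the
    first variable and ['Y = 'X%:P] the second. *)

Definition deg1 (R : realType) (p : {poly {poly C R}}) : nat := (size p).-1.
Definition deg2 (R : realType) (p : {poly {poly C R}}) : nat := (sizeY p).-1.

Definition reflection (R : realType) (p : {poly {poly C R}}) :
    {poly {poly C R}} :=
  \poly_(i < (deg1 p).+1) \poly_(j < (deg2 p).+1)
    (p`_(deg1 p - i)`_(deg2 p - j))^*.

Lemma reflectionE (R : realType) (p : {poly {poly C R}}) (z1 z2 : C R) :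
  z1 != 0 -> z2 != 0 ->
  (reflection p).[z1, z2] =
    z1 ^+ deg1 p * z2 ^+ deg2 p * (p.[(z1^*)^-1, (z2^*)^-1])^*.
Proof.
move=> z1N0 z2N0.
have evalE (q : {poly {poly C R}}) m (w1 w2 : C R) : (size q <= m)%N ->
    q.[w1, w2] = \sum_(i < m) (q`_i).[w2] * w1 ^+ i.
  move=> sq; rewrite (horner_coef_wide _ sq) horner_sum.
  by apply: eq_bigr => i _; rewrite hornerM -polyC_exp hornerC.
have conjV (z : C R) : ((z^*)^-1)^* = z^-1.
  by rewrite (fmorphV (Num.conj : {rmorphism C R -> C R})) /= conjCK.
have powB (z : C R) m k : z != 0 -> (k < m.+1)%N ->
    z ^+ (m - k) = z ^+ m * z^-1 ^+ k.
  rewrite ltnS => zN0 km; rewrite -[m in RHS](subnK km) exprD -mulrA -exprMn.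
  by rewrite mulfV// expr1n mulr1.
have s1 : (size (reflection p) <= (deg1 p).+1)%N by exact: size_poly.
have s2 : (size p <= (deg1 p).+1)%N by exact: leqSpred.
rewrite (evalE _ _ z1 z2 s1) (evalE _ _ _ _ s2).
rewrite rmorph_sum mulr_sumr (reindex_inj rev_ord_inj) /=.
apply: eq_bigr => i _; have ilt := ltn_ord i.
rewrite subSS coef_poly ltnS leq_subr subKn; last by rewrite -ltnS.
rewrite horner_poly.
have sp : (size (p`_i)%R <= (deg2 p).+1)%N.
  exact: leq_trans (max_size_coefXY _ _) (leqSpred _).
rewrite (horner_coef_wide _ sp) rmorphM /= rmorph_sum !mulr_suml mulr_sumr.
rewrite (reindex_inj rev_ord_inj) /=; apply: eq_bigr => j _.
have jlt := ltn_ord j.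
rewrite subSS subKn; last by rewrite -ltnS.
rewrite rmorphM !rmorphXn /= !conjV (powB z1)// (powB z2)//.
move: (_^*) (z1 ^+ _) (z2 ^+ _) (_^-1 ^+ _) (_^-1 ^+ _) => a b c d e; ring.
Qed.

(* Not [coprimep], which over [{poly C}] ignores the common factors in the
   second variable alone.  The units are the nonzero constants. *)
Definition no_common_factor (R : realType) (p q : {poly {poly C R}}) : Prop :=
  forall d a b : {poly {poly C R}},
    p = d * a -> q = d * b -> d \is a GRing.unit.

(* The value is [0] at the zeros of [r]. *)
Definition quotient (R : realType) (q r : {poly {poly C R}}) :
    C R * C R -> C R :=
  fun z => q.[z.1, z.2] / r.[z.1, z.2].

Definition rational_function (R : realType) (f : C R * C R -> C R) : Prop :=
  exists q r : {poly {poly C R}}, r != 0 /\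
    forall z, r.[z.1, z.2] != 0 -> f z = quotient q r z.

Definition rational_inner (R : realType) (f : C R * C R -> C R) : Prop :=
  [/\ rational_function f,
      forall z, bidisk R z -> differentiable f z,
      exists M : R, forall z, bidisk R z -> cmod (f z) <= M
    & torus_ae (fun z => cmod (f z) = 1)].

(* The distance to the point is compared with the distance to all of the faces
   of the bidisk, not only coordinate by coordinate. *)
Definition nontangential_to_11 (R : realType) (z : nat -> C R * C R) : Prop :=
  z @ \oo --> ((1, 1) : C R * C R) /\
  exists c : R, forall k,
    Num.max (cmod ((z k).1 - 1)) (cmod ((z k).2 - 1)) <=
      c * Num.min (1 - cmod (z k).1) (1 - cmod (z k).2).

Definition phi (R : realType) (p : {poly {poly C R}}) : C R * C R -> C R :=
  quotient (reflection p) p.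

Definition A1 (R : realType) (p : {poly {poly C R}}) : Prop :=
  [/\ rational_inner (phi p),
      forall z, bidisk R z -> p.[z.1, z.2] != 0,
      no_common_factor p (reflection p),
      p.[1, 1] = 0
    & forall z : nat -> C R * C R, (forall k, bidisk R (z k)) ->
        nontangential_to_11 z -> (fun k => phi p (z k)) @ \oo --> (1 : C R)].

Definition partial1 (R : realType) (f : C R * C R -> C R) (z : C R * C R) : C R :=
  derive1 (fun w : C R => f (w, z.2)) z.1.

Definition partial2 (R : realType) (f : C R * C R -> C R) (z : C R * C R) : C R :=
  derive1 (fun w : C R => f (z.1, w)) z.2.

(* Main.v *)
(** Near [(1, 1)] write [th1] and [th2] for the moduli of the two partial
    derivatives of [phi] on the torus; they are the angular derivatives of the
    one-variable finite Blaschke products [phi (., w)] and [phi (z, .)].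

    Angular derivative as a sum of Poisson kernels: if [w] is unimodular and
    [p (., w)] has degree [k] and zeros [a], all of modulus greater than 1, then
    [th1 (z, w) = (deg1 p - k) + sum_a (|a|^2 - 1) / |z - a|^2].

    Comparison: fix [z] and put [tau := phi (z, w)].  Lagrange interpolation at
    the points [v] with [phi (z, v) = tau] expresses the sum of the nonnegative
    numbers [th1 (z, v) / th2 (z, v)] through the coefficients of
    [reflection p - tau p] and of its [z]-derivative, which gives
    [th1 (z, w) |phi (z, w) - phi (z, 0)| <= B th2 (z, w)], with [B] uniform for
    [z] near 1.

    Integration in [x], where [z = exp (i x)], for fixed [w]: a zero
    [a = (1 + d) exp (i c)] of [p (., w)] near 1 contributes at most a multiple of
    [d^(1 - s)] to the integral of [th1^s].  Conversely, on [c - d <= x <= c + d]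
    the unimodular function [phi (., w)] turns too much to stay close to
    [phi (1, 0)], so the integral of [th1 |phi (z, w) - phi (z, 0)|] over that
    interval has a positive lower bound and, by the comparison, the integral of
    [th2^s] is at least a multiple of [d^(1 - s)].  Hence the integral of [th1^s]
    is bounded affinely by that of [th2^s] over a longer interval, with constants
    independent of [w].  Integrating in [w] gives one implication near [(1, 1)];
    exchanging the variables gives the other one.  Away from [(1, 1)] both
    derivatives are bounded, because [p] and [reflection p] are coprime, so that
    [(1, 1)] is an isolated zero of [p] on the torus. *)

Require Import Defs.
From mathcomp Require Import all_boot all_order all_algebra.
From mathcomp Require Import polyXY complex ring lra.
From mathcomp Require Import all_classical all_reals all_analysis.
From mathcomp Require Import measurable_realfun.

Set Implicit Arguments.
Unset Strict Implicit.
Unset Printing Implicit Defensive.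

Import Order.TTheory GRing.Theory Num.Theory numFieldNormedType.Exports.
Local Open Scope classical_set_scope.
Local Open Scope ring_scope.

(** * Reflected polynomials in one variable *)

Section OneVariable.
Variable F : numClosedFieldType.
Implicit Types (P Q : {poly F}) (z w : F) (m : nat).

(** The reflection z^m conj(P(1/conj z)) at a nominal degree [m]: a slice of a polynomial in two
    variables may have smaller degree, and the deficit shows up as a power of z. *)
Definition conj_rev m P : {poly F} := \poly_(i < m.+1) (P`_(m - i))^*.

Lemma coef_conj_rev m P i :
  (conj_rev m P)`_i = if (i <= m)%N then (P`_(m - i))^* else 0.
Proof. by rewrite coef_poly ltnS. Qed.

Lemma normf1_neq0 z : `|z| = 1 -> z != 0.
Proof. by move=> z1; rewrite -normr_eq0 z1 oner_eq0. Qed.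

Lemma normf1_conj z : `|z| = 1 -> z^* = z^-1.
Proof. by move=> z1; rewrite invC_norm z1 expr1n invr1 mul1r. Qed.

Lemma expf_subn z m k : z != 0 -> (k <= m)%N -> z ^+ (m - k) = z ^+ m * z^-1 ^+ k.
Proof. by move=> z0 km; rewrite expfB_cond ?(negPf z0) // exprVn. Qed.

Lemma conj_revE m P z : z != 0 -> (size P <= m.+1)%N ->
  (conj_rev m P).[z] = z ^+ m * (P.[(z^*)^-1])^*.
Proof.
move=> z0 sP; rewrite horner_poly (horner_coef_wide _ sP).
rewrite rmorph_sum mulr_sumr (reindex_inj rev_ord_inj) /=.
apply: eq_bigr => i _; rewrite subSS subKn -1?ltnS //.
rewrite rmorphM rmorphXn fmorphV /= conjCK expf_subn -1?ltnS //; ring.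
Qed.

(** The operator z d/dz multiplies the coefficient of index i by i, and the reversal turns i into m
    - i. *)
Lemma conj_rev_deriv m P z : `|z| = 1 -> (size P <= m.+1)%N ->
  z * (conj_rev m P)^`().[z] = z ^+ m * (m%:R * P.[z] - z * P^`().[z])^*.
Proof.
move=> z1 sP; have z0 := normf1_neq0 z1.
have sum_deriv Q : (size Q <= m.+1)%N ->
    z * Q^`().[z] = \sum_(i < m.+1) (i%:R * Q`_i) * z ^+ i.
  move=> sQ; rewrite (@horner_coef_wide _ m).
    rewrite big_ord_recl /= mul0r mul0r add0r mulr_sumr; apply: eq_bigr => i _.
    by rewrite coef_deriv /bump /= exprS -mulr_natl; ring.
  apply/leq_sizeP => j mj.
  by rewrite coef_deriv nth_default ?mul0rn // (leq_trans sQ).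
rewrite sum_deriv ?size_poly // sum_deriv // (horner_coef_wide _ sP) mulr_sumr.
rewrite -sumrB rmorph_sum mulr_sumr (reindex_inj rev_ord_inj) /=.
apply: eq_bigr => i _; have im : (i <= m)%N by rewrite -ltnS.
rewrite subSS coef_poly ltnS leq_subr subKn // expf_subn //.
rewrite rmorphB !rmorphM !rmorphXn /= !conjC_nat (normf1_conj z1) natrB //.
ring.
Qed.

Lemma logderiv_prod (rs : seq F) z : all (fun a => z != a) rs ->
  (\prod_(a <- rs) ('X - a%:P))^`().[z] =
  (\prod_(a <- rs) ('X - a%:P)).[z] * \sum_(a <- rs) (z - a)^-1.
Proof.
elim: rs => [|a rs IH]; first by rewrite !big_nil mulr0 derivC horner0.
move=> /= /andP[za /IH IHr]; rewrite !big_cons derivM derivXsubC mul1r.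
rewrite hornerD !hornerM IHr hornerXsubC mulrDr.
have : z - a != 0 by rewrite subr_eq0.
by move=> za0; field.
Qed.

(** For |a| > 1 and |z| = 1 this is the Poisson kernel of the point 1/conj a of the disk, since |z -
    a| = |1 - conj(a) z|. *)
Definition poisson z a : F := (`|a| ^+ 2 - 1) / `|z - a| ^+ 2.

(** On the circle this is z f'/f for f = Q/P with Q = [conj_rev m P], because z Q'/Q = m - conj(z
    P'/P) there. *)
Definition angular m P z : F :=
  m%:R - (z * P^`().[z] / P.[z] + (z * P^`().[z] / P.[z])^*).

(** P'/P is the sum of the 1/(z - a), and for |z| = 1 each root satisfies 1 - 2 Re(z/(z - a)) =
    [poisson z a]; the [m - size rs] missing roots contribute 1 each. *)
Lemma angularE m P (rs : seq F) c z : c != 0 ->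
  P = c *: \prod_(a <- rs) ('X - a%:P) -> (size rs <= m)%N ->
  `|z| = 1 -> P.[z] != 0 ->
  angular m P z = (m - size rs)%:R + \sum_(a <- rs) poisson z a.
Proof.
move=> c0 -> srs z1; rewrite hornerZ mulf_eq0 (negPf c0) /= => Pz.
have zrs : all (fun a => z != a) rs.
  apply/allP => a ars; apply: contraNneq Pz => ->.
  by rewrite -rootE root_prod_XsubC.
rewrite /angular derivZ !hornerZ (logderiv_prod zrs).
have -> : z * (c * ((\prod_(a <- rs) ('X - a%:P)).[z] * \sum_(a <- rs) (z - a)^-1))
   / (c * (\prod_(a <- rs) ('X - a%:P)).[z]) = \sum_(a <- rs) z / (z - a).
  by rewrite -mulr_sumr; field; rewrite c0 Pz.
rewrite natrB // -addrA; congr (_ + _).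
rewrite rmorph_sum /= -big_split /= -sum1_size natr_sum -!sumrN -big_split /=.
rewrite !big_seq; apply: eq_bigr => a ars.
have za : z - a != 0 by rewrite subr_eq0 (allP zrs).
have za' : (z - a)^* != 0 by rewrite conjC_eq0.
rewrite /poisson !normCK !rmorphM fmorphV /= !rmorphB /= (normf1_conj z1).
rewrite rmorphB /= (normf1_conj z1) in za'.
have z0 := normf1_neq0 z1.
field; rewrite z0 za andbT /=.
have -> : 1 + - a^* * z = z * (z^-1 - a^*) by field.
by rewrite mulf_neq0.
Qed.

(** The equality case is recorded because empty products give no strict inequality;
    [unimodular_level] treats it apart. *)
Lemma prod_lt (I : eqType) (rs : seq I) (f g : I -> F) :
  {in rs, forall a, 0 <= f a < g a} ->
  \prod_(a <- rs) f a <= \prod_(a <- rs) g a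
  ?= iff (rs == [::]).
Proof.
elim: rs => [|a rs IH] fg; first by rewrite !big_nil; apply/leif_refl.
rewrite !big_cons; apply/leifP => /=.
have /andP[fa fga] := fg a (mem_head _ _).
have fgr : {in rs, forall b, 0 <= f b < g b}.
  by move=> b brs; apply: fg; rewrite inE brs orbT.
apply: le_lt_trans (_ : f a * \prod_(b <- rs) g b < _).
  by apply: ler_wpM2l => //; rewrite (IH fgr).
rewrite ltr_pM2r // big_seq prodr_gt0 // => b /fgr /andP[fb].
exact: le_lt_trans.
Qed.

Lemma norm_reflect z a : `|z - a| ^+ 2 - `|1 - a^* * z| ^+ 2 =
  (1 - `|z| ^+ 2) * (`|a| ^+ 2 - 1).
Proof.
by rewrite !normCK !rmorphB rmorph1 rmorphM /= conjCK; ring.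
Qed.

Lemma norm_conj_rev m (rs : seq F) c z : (size rs <= m)%N -> z != 0 ->
  `|(conj_rev m (c *: \prod_(a <- rs) ('X - a%:P))).[z]| =
  `|z| ^+ (m - size rs) * `|c| * \prod_(a <- rs) `|1 - a^* * z|.
Proof.
move=> srs z0; rewrite conj_revE //; last first.
  by rewrite (leq_trans (size_scale_leq _ _)) // size_prod_XsubC.
rewrite hornerZ horner_prod normrM normrX norm_conjC normrM normr_prod.
have -> : \prod_(a <- rs) `|1 - a^* * z| =
    `|z| ^+ size rs * \prod_(a <- rs) `|('X - a%:P).[(z^*)^-1]|.
  elim: rs {srs} => [|a rs IH]; first by rewrite !big_nil mulr1.
  rewrite !big_cons IH hornerXsubC /= exprS.
  have -> : `|1 - a^* * z| = `|z| * `|(z^*)^-1 - a|.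
    rewrite -[X in _ = _ * X]norm_conjC -normrM rmorphB fmorphV /= conjCK.
    by congr `|_|; field.
  ring.
rewrite -{1}(subnK srs) exprD; ring.
Qed.

(** By [norm_reflect], |1 - conj(a) z| lies below |z - a| inside the disk and above it outside, so
    the Blaschke product Q/P has modulus 1 on the circle only. Without roots the factor |z|^m
    decides, whence [0 < m]. *)
Lemma unimodular_level m (rs : seq F) c z (P := c *: \prod_(a <- rs) ('X - a%:P)) :
  (size rs <= m)%N -> (0 < m)%N -> c != 0 -> {in rs, forall a, 1 < `|a|} ->
  z != 0 -> `|(conj_rev m P).[z]| = `|P.[z]| -> `|z| = 1.
Proof.
move=> srs m0 c0 ars z0; rewrite norm_conj_rev // hornerZ horner_prod normrM.
rewrite normr_prod; under [in RHS]eq_bigr do rewrite hornerXsubC.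
rewrite [_ * `|c|]mulrC -mulrA => /(mulfI _); rewrite normr_eq0 => /(_ c0).
have [z1 E|z1 E|//] := real_ltgtP (normr_real z) (real1 F).
- have /prod_lt/leifP : {in rs, forall a, 0 <= `|1 - a^* * z| < `|z - a|}.
    move=> a /ars a1; rewrite normr_ge0 /= -(@ltr_pXn2r _ 2) ?nnegrE //.
    by rewrite -subr_gt0 norm_reflect mulr_gt0 // subr_gt0 ?expr_lt1 ?expr_gt1.
  case: eqP E => [->|_] /=.
    rewrite !big_nil mulr1 subn0 => /eqP; rewrite (@pexpr_eq1 _ _ m) //.
    by move/eqP.
  move=> <-; rewrite le_gtF //.
  by rewrite ler_piMl ?prodr_ge0 // exprn_ile1 // ltW.
- have /prod_lt/leifP : {in rs, forall a, 0 <= `|z - a| < `|1 - a^* * z|}.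
    move=> a /ars a1; rewrite normr_ge0 /= -(@ltr_pXn2r _ 2) ?nnegrE //.
    rewrite -subr_lt0 norm_reflect nmulr_rlt0 ?subr_gt0 ?subr_lt0 ?expr_lt1 ?expr_gt1 //.
  case: eqP E => [->|_] /=.
    rewrite !big_nil mulr1 subn0 => /eqP; rewrite (@pexpr_eq1 _ _ m) //.
    by move/eqP.
  move=> <-; rewrite le_gtF //.
  by rewrite ler_peMl ?prodr_ge0 // exprn_ege1 // ltW.
Qed.

(** Subtracting from [r] the multiple of [q] that cancels the coefficient of index m leaves a
    polynomial of size at most m, determined by its values at the m roots of [q]. The identity is
    its interpolation formula at 0, divided by [- q.[0]]. *)
Lemma lagrange_at0 m (q r : {poly F}) (ws : seq F) :
  uniq ws -> size ws = m -> (size q <= m.+1)%N -> (size r <= m.+1)%N ->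
  q`_m != 0 -> all (root q) ws ->
  q.[0] != 0 ->
  r`_m / q`_m - r.[0] / q.[0] =
  \sum_(w <- ws) r.[w] / (w * q^`().[w]).
Proof.
move=> uws sws sq sr qm qws q0.
have {}sq : size q = m.+1.
  apply/eqP; rewrite eqn_leq sq ltnNge; apply: contra qm => sqm.
  by rewrite nth_default.
have Eq : q = q`_m *: \prod_(w <- ws) ('X - w%:P).
  rewrite {1}(@all_roots_prod_XsubC _ q ws) ?uniq_rootsE ?sq ?sws //.
  by rewrite lead_coefE sq.
pose L w := \prod_(x <- rem w ws) ('X - x%:P).
have prodE w : w \in ws -> \prod_(w <- ws) ('X - w%:P) = ('X - w%:P) * L w.
  by move=> wws; rewrite (perm_big _ (perm_to_rem wws)) big_cons.
have dq w : w \in ws -> q^`().[w] = q`_m * (L w).[w].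
  move=> wws; rewrite {1}Eq derivZ (prodE w wws) derivM derivXsubC mul1r.
  by rewrite hornerZ hornerD hornerM hornerXsubC subrr mul0r addr0.
have Lw w : w \in ws -> (L w).[w] != 0.
  move=> wws; rewrite -rootE root_prod_XsubC; move: uws.
  by rewrite (perm_uniq (perm_to_rem wws)) => /andP[].
have w0 w : w \in ws -> w != 0.
  by move=> wws; apply: contraNneq q0 => E; have := allP qws w wws; rewrite E.
(* The interpolation error: size at most m and m distinct zeros force it to be 0. *)
pose s := r - (r`_m / q`_m) *: q - \sum_(w <- ws) (r.[w] / (L w).[w]) *: L w.
have sL w : w \in ws -> size (L w) = m.
  move=> wws; rewrite size_prod_XsubC size_rem // sws prednK // -sws.
  by case: (ws) wws.
have s0 : s = 0.
  apply: (@roots_geq_poly_eq0 _ _ ws) => //; last first.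
    rewrite sws; apply: leq_trans (size_polyD _ _) _; rewrite geq_max.
    apply/andP; split.
      apply/leq_sizeP => j; rewrite leq_eqVlt coefB coefZ => /predU1P[<-|mj].
        by rewrite divfK ?subrr.
      rewrite (nth_default _ (leq_trans sr mj)).
      have -> : q`_j = 0 by rewrite nth_default ?sq.
      by rewrite mulr0 subrr.
    rewrite size_polyN big_seq; apply: leq_trans (size_sum _ _ _) _.
    apply/bigmax_leqP_seq => w _ wws.
    by rewrite (leq_trans (size_scale_leq _ _)) ?sL.
  apply/allP => w wws; apply/eqP; rewrite /s !hornerD !hornerN hornerZ horner_sum.
  rewrite (eqP (allP qws w wws)) mulr0 subr0 (bigD1_seq w) //= hornerZ.
  rewrite divfK ?Lw // big_seq_cond big1 ?addr0 ?subrr // => x /andP[xws xw].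
  rewrite hornerZ; apply/eqP; rewrite mulf_eq0; apply/orP; right.
  rewrite -rootE root_prod_XsubC -[w \in _]/(w \in rem x ws).
  by rewrite rem_filter // mem_filter /= eq_sym xw.
have: s.[0] == 0 by rewrite s0 horner0.
rewrite /s !hornerD !hornerN hornerZ horner_sum subr_eq0 => /eqP E.
have -> : r`_m / q`_m - r.[0] / q.[0] =
    - (r.[0] - r`_m / q`_m * q.[0]) / q.[0].
  by field; rewrite q0 qm.
rewrite E -sumrN mulr_suml !big_seq; apply: eq_bigr => w wws.
have -> : q.[0] = q`_m * (- w * (L w).[0]).
  by rewrite {1}Eq (prodE w wws) hornerZ hornerM hornerXsubC sub0r.
have L0 : (L w).[0] != 0.
  apply: contraNneq q0 => L0.
  by rewrite Eq (prodE w wws) hornerZ hornerM L0 !mulr0.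
rewrite dq // hornerZ; have Lw0 := Lw w wws; have ww0 := w0 w wws.
by field; rewrite L0 qm ww0 Lw0.
Qed.
End OneVariable.

(** * Polynomials in two variables *)

Section TwoVariables.
Variable F : numClosedFieldType.
Implicit Types (p q u v d : {poly {poly F}}) (P c : {poly F}) (z w : F).

(** The second variable is frozen here; freezing the first one is plain evaluation [p.[z%:P]]. *)
Definition slice w p : {poly F} := map_poly (horner_eval w) p.

Lemma horner_slice w p z : (slice w p).[z] = p.[z, w].
Proof. by rewrite -[z in LHS](hornerC z w) horner_map. Qed.

Lemma horner_swap_slice z p : p.[z%:P] = slice z (swapXY p).
Proof. exact: horner_polyC. Qed.

Lemma slice_eq0_factor w p : slice w p = 0 -> exists u, p = ('X - w%:P)%:P * u.
Proof.
move=> p0; exists (map_poly (fun c => c %/ ('X - w%:P)) p).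
apply/polyP => i; rewrite coefCM coef_map_id0 ?div0p // mulrC divpK //.
rewrite dvdp_XsubCl /root.
by have /polyP/(_ i) := p0; rewrite coef0 coef_map /= horner_evalE => ->.
Qed.

Lemma polyC_XsubC_neq0 w : ('X - w%:P)%:P != 0 :> {poly {poly F}}.
Proof. by rewrite polyC_eq0 polyXsubC_eq0. Qed.

(** As long as some slice vanishes, a factor X - w of all coefficients is split off; this lowers the
    degree of the leading coefficient, so it stops. *)
Lemma primitive_part p : p != 0 ->
  exists c u, p = c%:P * u /\ forall w, slice w u != 0.
Proof.
have [n] := ubnP (size (lead_coef p)); elim: n p => // n IH p sp p0.
have [[w /slice_eq0_factor [u pE]]|nw] := pselect (exists w, slice w p = 0).
- have u0 : u != 0 by apply: contraNneq p0 => u0; rewrite pE u0 mulr0.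
  have [|c [v [uE vs]]] := IH u _ u0.
    move: sp; rewrite pE lead_coefM lead_coefC size_monicM ?monicXsubC //.
      by rewrite size_XsubC.
    by rewrite lead_coef_eq0.
  by exists (('X - w%:P) * c), v; rewrite pE uE polyCM mulrA.
- by exists 1, p; rewrite mul1r; split=> // w; apply: contra_notN nw => /eqP; exists w.
Qed.

(** Gauss's lemma, one root of [c] at a time: at a root w the slice of [q * u] is 0, hence that of
    [q] is, and X - w cancels on both sides. *)
Lemma gauss_divide c p q u : c != 0 -> (forall w, slice w u != 0) ->
  c%:P * p = q * u -> exists v, p = v * u.
Proof.
move=> c0 us; have [n] := ubnP (size c); elim: n c c0 q => // n IH c c0 q sc E.
have [/size_poly1P[k k0 cE]|/closed_rootP[w]] := boolP (size c == 1%N).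
  exists ((k^-1)%:P%:P * q); rewrite -mulrA -E cE mulrA -!polyCM.
  by rewrite mulVf // mul1r.
move=> /factor_theorem [c' cE].
have : slice w q * slice w u = 0.
  rewrite /slice -rmorphM -E rmorphM /= cE map_polyC /= horner_evalE.
  by rewrite hornerM hornerXsubC subrr mulr0 mul0r.
move=> /eqP; rewrite mulf_eq0 (negPf (us w)) orbF => /eqP/slice_eq0_factor[q' qE].
have c'0 : c' != 0 by apply: contraNneq c0 => E0; rewrite cE E0 mul0r.
apply: (IH c' c'0 q').
  by move: sc; rewrite cE size_Mmonic ?monicXsubC // size_XsubC addn2.
apply: (mulfI (polyC_XsubC_neq0 w)); rewrite mulrA -polyCM mulrC [_ * c']mulrC -cE.
by rewrite mulrC E qE; ring.
Qed.

(** The greatest common divisor over the fraction field of the coefficients is constant in the first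
    variable: otherwise, by Gauss's lemma, its primitive part would be a common factor that is not a
    unit. Bezout's identity then eliminates the first variable. *)
Lemma coprime_eliminate p q :
  (forall d u v, p = d * u -> q = d * v -> d \is a GRing.unit) ->
  exists2 c, c != 0 & exists u v, c%:P = u * p + v * q.
Proof.
move=> pq; pose g := gcdp p q.
have g0 : g != 0.
  (* If both polynomials were 0, then 0 would be a common factor, hence a unit. *)
  rewrite gcdp_eq0; apply/negP => /andP[/eqP p0 /eqP q0].
  by have := pq 0 0 0; rewrite p0 q0 mulr0 unitr0 => /(_ erefl erefl).
have [sg|sg] := leqP (size g) 1.
  have /eqpP[[c1 c2] /= /andP[c10 c20] E] := egcdpE p q.
  have gE := size1_polyC sg; have gc0 : g`_0 != 0.
    by rewrite -polyC_eq0 -gE.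
  exists (c1 * g`_0); first by rewrite mulf_neq0.
  exists (c2 *: (egcdp p q).1), (c2 *: (egcdp p q).2).
  by rewrite polyCM -gE mul_polyC E scalerDr !scalerAl.
have [c [u [gE us]]] := primitive_part g0.
have gdiv r : g %| r -> exists v, r = v * u.
  move=> /Pdiv.Idomain.dvdpP[[a b] /= a0]; rewrite gE -mul_polyC mulrA.
  exact: gauss_divide.
have [a pE] := gdiv _ (dvdp_gcdl p q); have [b qE] := gdiv _ (dvdp_gcdr p q).
have : u \is a GRing.unit by apply: (pq u a b); rewrite mulrC.
rewrite poly_unitE => /andP[/eqP su _]; move: sg.
have c0 : c != 0 by apply: contraNneq g0 => c0; rewrite gE c0 mul0r.
by rewrite gE size_Cmul // su.
Qed.

Lemma poly_disk_bound P z : `|z| <= 1 -> `|P.[z]| <= \sum_(i < size P) `|P`_i|.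
Proof.
move=> z1; rewrite horner_coef; apply: le_trans (ler_norm_sum _ _ _) _.
apply: ler_sum => i _; rewrite normrM normrX ler_piMr //.
by rewrite exprn_ile1.
Qed.

(* If a polynomial has no root in a disk centred at [z0], its modulus at most
   doubles for each root between [z0] and a point of the disk; so its values
   near [z0] vanish in the limit together with the value at [z0]. *)
Lemma zero_free_half_closed p w z0 :
  (forall z w, `|z| < 1 -> `|w| < 1 -> p.[z, w] != 0) ->
  `|w| = 1 -> `|z0| < 1 -> slice w p != 0 -> p.[z0, w] != 0.
Proof.
move=> pD w1 z01 sw; apply/negP => /eqP pz0.
have bound z t : `|z - z0| <= 1 - `|z0| -> 0 <= t -> t < 1 ->
    `|p.[z, t * w]| <= 2 ^+ size p * `|p.[z0, t * w]|.
  move=> zz0 t0 t1; have tw1 : `|t * w| < 1 by rewrite normrM w1 mulr1 ger0_norm.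
  have [rs E] := closed_field_poly_normal (slice (t * w) p).
  set k := lead_coef _ in E.
  have k0 : k != 0.
    apply: contraNneq (pD z0 _ z01 tw1) => k0.
    by rewrite -horner_slice E k0 scale0r horner0.
  have rs1 a : a \in rs -> 1 <= `|a|.
    move=> ars; have [//|a1] := real_leP (real1 F) (normr_real a).
    have /negP[] := pD a _ a1 tw1; rewrite -horner_slice E hornerZ mulf_eq0.
    by apply/orP; right; rewrite -/(root _ _) root_prod_XsubC.
  have srs : (size rs <= size p)%N.
    apply: ltnW; rewrite -(size_prod_XsubC rs id) -(size_scale _ k0) -E.
    exact: size_poly.
  rewrite -!horner_slice E !hornerZ !normrM mulrCA ler_pM2l ?normr_gt0 //.
  apply: (@le_trans _ _ (2 ^+ size rs * `|(\prod_(a <- rs) ('X - a%:P)).[z0]|)).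
    rewrite !horner_prod !normr_prod.
    elim: rs rs1 {E srs} => [|a rs IH] rs1; first by rewrite !big_nil mulr1.
    rewrite !big_cons !hornerXsubC exprS mulrACA ler_pM //.
      rewrite prodr_ge0 //.
    have az0 : `|z - z0| <= `|z0 - a|.
      apply: le_trans zz0 _; rewrite lerBlDr (le_trans (rs1 a (mem_head _ _))) //.
      by rewrite -{1}[a](subrK z0) distrC ler_normD.
      rewrite mulr_natl mulr2n -{1}(subrK z0 z) -addrA (le_trans (ler_normD _ _)) //.
      by rewrite lerD.
    by apply: IH => b brs; apply: rs1; rewrite inE brs orbT.
  by rewrite ler_wpM2r // ler_weXn2l // ler1n.
(* At t w, with t < 1, the values are within a multiple of 1 - t of those at w, so [bound] gives
   |p(z, w)| <= M e for every e in ]0, 1]. *)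
have vanish z : `|z - z0| <= 1 - `|z0| -> p.[z, w] = 0.
  move=> zz0; pose h x : {poly F} := p.[x%:P] \Po (w *: 'X).
  have hE x t : (h x).[t] = p.[x, t * w].
    by rewrite horner_comp hornerZ hornerX mulrC.
  have h1 x : (h x).[1] = p.[x, w] by rewrite hE mul1r.
  have div1 x : exists2 A, 0 <= A & forall t, 0 <= t -> t < 1 ->
      `|p.[x, t * w] - p.[x, w]| <= A * (1 - t).
    have /factor_theorem[k kE] : root (h x - (h x).[1]%:P) 1.
      by rewrite /root !hornerE subrr.
    exists (\sum_(i < size k) `|k`_i|); first exact: sumr_ge0.
    move=> t t0 t1; have -> : p.[x, t * w] - p.[x, w] = k.[t] * (t - 1).
      have /(congr1 (horner^~ t)) := kE.
      by rewrite /= hornerD hornerN hornerC hornerM hornerXsubC h1 hE.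
    have t1' : 0 <= 1 - t by rewrite subr_ge0 ltW.
    rewrite normrM distrC (ger0_norm t1') ler_wpM2r // poly_disk_bound //.
    by rewrite ger0_norm // ltW.
  have [A A0 Az] := div1 z; have [B B0 Bz] := div1 z0.
  pose M := 2 ^+ size p * B + A; have M0 : 0 <= M.
    by rewrite addr_ge0 // mulr_ge0 // exprn_ge0.
  have le_e e : 0 < e -> e <= 1 -> `|p.[z, w]| <= M * e.
    move=> e0 e1; pose t := 1 - e.
    have t0 : 0 <= t by rewrite subr_ge0.
    have t1 : t < 1 by rewrite ltrBlDr ltrDl.
    have eE : e = 1 - t by rewrite /t; ring.
    clearbody t.
    rewrite -[p.[z, w]](subrK p.[z, t * w]) addrC.
    apply: le_trans (ler_normD _ _) _; rewrite mulrDl lerD //; last first.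
      by rewrite distrC eE Az.
    apply: le_trans (bound _ _ zz0 t0 t1) _; rewrite -mulrA ler_wpM2l ?exprn_ge0 //.
    by rewrite eE -[X in `|X|]subr0 -pz0 Bz.
  apply/eqP; rewrite -normr_le0; set x := `|p.[z, w]| in le_e *.
  have x0 : 0 <= x by apply: normr_ge0.
  move: x0; rewrite le_eqVlt => /predU1P[<-//|x0].
  have xM : 0 < x + M by apply: ltr_wpDr.
  (* For e = x / (x + M) the inequality x <= M e becomes x^2 <= 0. *)
  have := le_e (x / (x + M)); rewrite divr_gt0 // ler_pdivrMr // mul1r lerDl.
  rewrite mulrA ler_pdivlMr // => /(_ isT M0) xle.
  have : x * x <= 0 by rewrite -(lerD2r (x * M)) add0r -mulrDr (le_trans xle) // mulrC.
  by rewrite lt_geF // mulr_gt0.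
pose e : F := 1 - `|z0|; have e0 : 0 < e by rewrite subr_gt0.
(* More points around [z0] than the nonzero slice can have roots. *)
pose rs := [seq z0 + e / (i.+1)%:R | i <- iota 0 (size (slice w p))].
have := @max_poly_roots _ (slice w p) rs sw; rewrite size_map size_iota ltnn => noroots.
suff : false by []; apply: noroots.
  apply/allP => _ /mapP[i _ ->]; rewrite /root horner_slice vanish //.
  rewrite addrC addKr normrM normfV normr_nat (gtr0_norm e0) -/e.
  by rewrite ler_pdivrMr ?ltr0n // ler_peMr ?(ltW e0) // ler1n.
rewrite map_inj_uniq ?iota_uniq // => i j /addrI/(mulfI (lt0r_neq0 e0))/invr_inj.
by move/eqP; rewrite eqr_nat eqSS => /eqP.
Qed.
End TwoVariables.

(** * Stable polynomials and their reflections *)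

Section Reflection.
Variable R : realType.
Implicit Types (p u : {poly {poly C R}}) (P Q : {poly C R}) (z w v : C R).

Lemma coef_reflection p i j : (reflection p)`_i`_j =
  if (i <= deg1 p)%N && (j <= deg2 p)%N then (p`_(deg1 p - i)`_(deg2 p - j))^* else 0.
Proof.
rewrite coef_poly ltnS; case: (i <= _)%N => /=; last by rewrite coef0.
by rewrite coef_poly ltnS.
Qed.

Lemma deg1_swap p : deg1 (swapXY p) = deg2 p.
Proof. by rewrite /deg1 /deg2 sizeYE. Qed.

Lemma deg2_swap p : deg2 (swapXY p) = deg1 p.
Proof. by rewrite /deg1 /deg2 sizeYE swapXYK. Qed.

Lemma reflection_swap p : reflection (swapXY p) = swapXY (reflection p).
Proof.
apply/polyP => i; apply/polyP => j; rewrite coef_swapXY !coef_reflection.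
by rewrite deg1_swap deg2_swap coef_swapXY andbC.
Qed.

Lemma size_slice w p : (size (slice w p) <= (deg1 p).+1)%N.
Proof. exact: leq_trans (size_poly _ _) (leqSpred _). Qed.

Lemma size_swap_slice z p : (size p.[z%:P] <= (deg2 p).+1)%N.
Proof. by rewrite horner_swap_slice -deg1_swap size_slice. Qed.

(** As conj w = 1/w, a reversed conjugated coefficient takes at w the value w^n times the conjugate
    of the original one, where n is [deg2 p]. *)
Lemma slice_reflection p w : `|w| = 1 ->
  slice w (reflection p) = w ^+ deg2 p *: conj_rev (deg1 p) (slice w p).
Proof.
move=> w1; have w0 := normf1_neq0 w1; apply/polyP => i.
rewrite coefZ coef_map /= horner_evalE coef_conj_rev coef_poly ltnS.
case: leqP => im; last by rewrite horner0 mulr0.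
rewrite horner_poly coef_map /= horner_evalE.
have sp : (size (p`_(deg1 p - i))%R <= (deg2 p).+1)%N.
  exact: leq_trans (max_size_coefXY _ _) (leqSpred _).
rewrite (horner_coef_wide _ sp) rmorph_sum mulr_sumr (reindex_inj rev_ord_inj) /=.
apply: eq_bigr => j _; rewrite subSS subKn -1?ltnS // rmorphM rmorphXn /=.
have jn : (j <= deg2 p)%N by rewrite -ltnS.
rewrite (normf1_conj w1) exprVn (expf_subn w0 jn).
by rewrite exprVn mulrCA.
Qed.

Lemma swap_slice_reflection p z : `|z| = 1 ->
  (reflection p).[z%:P] = z ^+ deg1 p *: conj_rev (deg2 p) p.[z%:P].
Proof.
move=> z1; rewrite !horner_swap_slice -reflection_swap slice_reflection //.
by rewrite deg1_swap deg2_swap.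
Qed.

(** Both conditions survive the exchange of the variables, so each one-sided estimate below serves
    for either partial derivative. *)
Definition stable_pair p :=
  (forall z w, `|z| < 1 -> `|w| < 1 -> p.[z, w] != 0) /\
  no_common_factor p (reflection p).

Lemma stable_pair_swap p : stable_pair p -> stable_pair (swapXY p).
Proof.
move=> [pD pp]; split=> [z w z1 w1|d u v E1 E2].
  by rewrite horner2_swapXY pD.
rewrite -[d]swapXYK; apply: (rmorph_unit (swapXY : {rmorphism _ -> _})).
apply: (pp _ (swapXY u) (swapXY v)).
  by rewrite -rmorphM -E1 /= swapXYK.
by rewrite -rmorphM -E2 /= reflection_swap swapXYK.
Qed.

(** For |w| = 1 a vanishing slice of [p] forces that of the reflection to vanish, and the linear
    factor of root w in the second variable would divide both. *)
Lemma slice_neq0 p w : stable_pair p -> `|w| = 1 -> slice w p != 0.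
Proof.
move=> [_ pp] w1; apply/eqP => s0.
have [u pE] := slice_eq0_factor s0.
have [|v rE] := @slice_eq0_factor _ w (reflection p).
  rewrite slice_reflection // s0; apply/polyP => i.
  by rewrite coefZ coef0 coef_conj_rev coef0 conjC0 if_same mulr0.
have := pp _ _ _ pE rE; rewrite poly_unitE coefC eqxx poly_unitE size_XsubC.
by rewrite andbF.
Qed.

Lemma slice_disk_neq0 p z w : stable_pair p -> `|z| < 1 -> `|w| = 1 ->
  p.[z, w] != 0.
Proof.
by move=> sp z1 w1; case: (sp) => pD _; rewrite (zero_free_half_closed pD) ?slice_neq0.
Qed.

(** On the torus a zero of [p] is also one of its reflection, so the polynomial [c] obtained by
    elimination vanishes at its second coordinate. *)
Lemma torus_zeros p : stable_pair p -> exists2 c : {poly C R}, c != 0 &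
  forall z w, `|z| = 1 -> `|w| = 1 -> c.[w] != 0 -> p.[z, w] != 0.
Proof.
move=> [_ /coprime_eliminate [c c0 [u [v cE]]]]; exists c => // z w z1 w1.
apply: contraNneq => pzw; have r0 : (reflection p).[z, w] = 0.
  rewrite -horner_slice slice_reflection // hornerZ conj_revE ?size_slice ?normf1_neq0 //.
  rewrite (normf1_conj z1) invrK horner_slice pzw conjC0 !mulr0 //.
have /(congr1 (fun x : {poly {poly C R}} => x.[z, w])) := cE.
by rewrite hornerC !hornerE pzw r0 !mulr0 addr0 => ->.
Qed.

Lemma slice_roots p w (c := lead_coef (slice w p)) : stable_pair p -> `|w| = 1 ->
  exists rs : seq (C R), [/\ c != 0, slice w p = c *: \prod_(a <- rs) ('X - a%:P),
    (size rs <= deg1 p)%N, {in rs, forall a, 1 <= `|a|} &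
    (forall z, `|z| = 1 -> p.[z, w] != 0) -> {in rs, forall a, 1 < `|a|}].
Proof.
move=> sp w1; have s0 := slice_neq0 sp w1.
have [rs E] := closed_field_poly_normal (slice w p).
have c0 : c != 0 by rewrite lead_coef_eq0.
have ps0 a : a \in rs -> p.[a, w] = 0.
  move=> ars; rewrite -horner_slice E hornerZ.
  have /rootP-> : root (\prod_(a <- rs) ('X - a%:P)) a by rewrite root_prod_XsubC.
  by rewrite mulr0.
have rs1 : {in rs, forall a, 1 <= `|a|}.
  move=> a /ps0 /eqP; have [//|a1] := real_leP (real1 _) (normr_real a).
  by rewrite (negPf (slice_disk_neq0 sp a1 w1)).
exists rs; split=> //.
- rewrite -ltnS -(size_prod_XsubC rs id) -(size_scale _ c0) -E size_slice //.
- move=> pT a ars; rewrite lt_neqAle rs1 // andbT eq_sym; apply/eqP => a1.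
  by have := pT a a1; rewrite ps0 ?eqxx.
Qed.

Lemma poisson_ge0 z a : 1 <= `|a| -> 0 <= poisson z a.
Proof. by move=> a1; rewrite divr_ge0 ?exprn_ge0 // subr_ge0 exprn_ege1. Qed.

Lemma poisson_gt0 z a : `|z| = 1 -> 1 < `|a| -> 0 < poisson z a.
Proof.
move=> z1 a1; rewrite divr_gt0 ?exprn_gt0 ?subr_gt0 ?exprn_egt1 //.
by rewrite normr_gt0 subr_eq0; apply: contraTneq a1 => <-; rewrite z1 ltxx.
Qed.

Lemma angular_ge0 p z w : stable_pair p -> `|z| = 1 -> `|w| = 1 -> p.[z, w] != 0 ->
  0 <= angular (deg1 p) (slice w p) z.
Proof.
move=> sp z1 w1 pzw; have [rs [c0 E srs rs1 _]] := slice_roots sp w1.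
rewrite (angularE c0 E srs z1) ?horner_slice // addr_ge0 // big_seq sumr_ge0 //.
by move=> a /rs1; apply: poisson_ge0.
Qed.

(** Either the slice is constant and the missing degree counts, or a root lies strictly outside the
    closed disk and its Poisson kernel is positive. *)
Lemma angular_gt0 p z w : stable_pair p -> `|z| = 1 -> `|w| = 1 -> (0 < deg1 p)%N ->
  (forall v, `|v| = 1 -> p.[v, w] != 0) ->
  0 < angular (deg1 p) (slice w p) z.
Proof.
move=> sp z1 w1 m0 pT; have [rs [c0 E srs rs1 /(_ pT) rs2]] := slice_roots sp w1.
rewrite (angularE c0 E srs z1) ?horner_slice ?pT //.
case: rs E srs rs1 rs2 => [|a rs] E srs rs1 rs2.
  by rewrite big_nil addr0 subn0 ltr0n.
rewrite big_cons addrCA ltr_pwDl //.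
  by rewrite poisson_gt0 ?rs2 ?mem_head.
rewrite addr_ge0 // big_seq sumr_ge0 // => b brs.
by rewrite poisson_ge0 // rs1 // inE brs orbT.
Qed.

(** The left side is z P (Q/P)'. It is also z times the derivative at z of Q - tau P, with the
    constant tau = Q(z)/P(z). *)
Lemma angular_logderiv m P Q c z : `|z| = 1 -> (size P <= m.+1)%N -> P.[z] != 0 ->
  Q = c *: conj_rev m P ->
  z * (Q^`().[z] - Q.[z] / P.[z] * P^`().[z]) = Q.[z] * angular m P z.
Proof.
move=> z1 sP P0 ->; rewrite derivZ !hornerZ.
have -> : z * (c * (conj_rev m P)^`().[z] - c * (conj_rev m P).[z] / P.[z] * P^`().[z])
  = c * (z * (conj_rev m P)^`().[z] - (conj_rev m P).[z] * (z * P^`().[z] / P.[z])).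
  by field.
rewrite conj_rev_deriv // conj_revE ?normf1_neq0 // (normf1_conj z1) invrK /angular.
rewrite !rmorphB !rmorphM fmorphV /= conjC_nat.
have P0' : P.[z]^* != 0 by rewrite conjC_eq0.
by field; rewrite P0'.
Qed.

Lemma uniq_roots_deriv (ws : seq (C R)) :
  {in ws, forall w, (\prod_(a <- ws) ('X - a%:P))^`().[w] != 0} -> uniq ws.
Proof.
elim: ws => //= w ws IH; rewrite big_cons derivM derivXsubC mul1r => H.
apply/andP; split.
  have := H w (mem_head _ _); rewrite hornerD hornerM hornerXsubC subrr mul0r addr0.
  by rewrite -[_ == _]/(root _ _) root_prod_XsubC.
apply: IH => v vws; have := H v; rewrite inE vws orbT => /(_ isT).
rewrite hornerD hornerM; have /rootP-> : root (\prod_(a <- ws) ('X - a%:P)) v.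
  by rewrite root_prod_XsubC.
by rewrite add0r mulf_eq0 negb_or => /andP[].
Qed.

Definition coef_bound u k : C R := \sum_(i < size u) `|u`_i`_k|.

Lemma coef_bound_ge0 u k : 0 <= coef_bound u k.
Proof. exact: sumr_ge0. Qed.

Lemma coef_boundP u k z : `|z| = 1 -> `|u.[z%:P]`_k| <= coef_bound u k.
Proof.
move=> z1; rewrite horner_coef coef_sum; apply: le_trans (ler_norm_sum _ _ _) _.
apply: ler_sum => i _.
by rewrite -polyC_exp coefMC normrM normrX z1 expr1n mulr1.
Qed.

(** The Lagrange identity involves only the coefficients of index 0 and [deg2 p] of the z-derivative
    of [reflection p - tau p]; this bounds both for all unimodular z and tau. *)
Definition slope_bound p : C R :=
  \sum_(k <- [:: 0%N; deg2 p])
    (coef_bound (reflection p)^`() k + coef_bound p^`() k).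

Lemma slope_bound_ge0 p : 0 <= slope_bound p.
Proof. by apply: sumr_ge0 => k _; rewrite addr_ge0 ?coef_bound_ge0. Qed.

Lemma deriv_slice w u : (slice w u)^`() = slice w u^`().
Proof. exact: deriv_map. Qed.

(* With [tau := phi p (z, w)], Lagrange interpolation at the points [v] of
   [phi p (z, v) = tau] evaluates [sum_v angular1 (z, v) / angular2 (z, v)],
   a sum of nonnegative terms, as a quotient whose denominator is controlled by
   the distance from [phi p (z, 0)] to [tau]. *)
Lemma angular_compare p z w : stable_pair p -> `|z| = 1 -> `|w| = 1 ->
  (forall v, `|v| = 1 -> p.[z, v] != 0) ->
  angular (deg1 p) (slice w p) z * `|phi p (z, w) - phi p (z, 0)| * `|p.[z, 0]|
  <= slope_bound p * angular (deg2 p) p.[z%:P] w.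
Proof.
move=> sp z1 w1 pT; have z0 := normf1_neq0 z1.
have sp' := stable_pair_swap sp.
have swE v : p.[z, v] = (swapXY p).[v, z] by rewrite horner2_swapXY.
set m := deg1 p; set n := deg2 p.
have sliceE : p.[z%:P] = slice z (swapXY p) by rewrite horner_swap_slice.
set tau := phi p (z, w); set P := p.[z%:P]; set Q := (reflection p).[z%:P].
have tauE : tau = Q.[w] / P.[w] by []. clearbody tau.
have QE : Q = z ^+ m *: conj_rev n P by exact: swap_slice_reflection.
have sP : (size P <= n.+1)%N by exact: size_swap_slice.
have normQ v : `|v| = 1 -> `|Q.[v]| = `|P.[v]|.
  move=> v1; rewrite QE hornerZ conj_revE ?normf1_neq0 // (normf1_conj v1) invrK.
  by rewrite !normrM !normrX z1 v1 !expr1n !mul1r norm_conjC.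
have Pw0 : P.[w] != 0 by exact: pT.
have tau1 : `|tau| = 1 by rewrite tauE normrM normfV normQ // divff ?normr_eq0.
have tau0 := normf1_neq0 tau1.
have T2_ge0 : 0 <= angular n P w.
  by rewrite /P sliceE /n -deg1_swap angular_ge0 // -swE pT.
(* The roots of [q] will be the solutions v of phi p (z, v) = tau. *)
pose q := Q - tau *: P.
have p00 : P.[0] != 0 by rewrite /P swE slice_disk_neq0 // normr0.
have q0E : q.[0] = P.[0] * (phi p (z, 0) - tau).
  rewrite /q hornerD hornerN hornerZ /phi /quotient /= -/P -/Q.
  by field.
rewrite -mulrA.
have -> : `|tau - phi p (z, 0)| * `|p.[z, 0]| = `|q.[0]|.
  by rewrite q0E normrM distrC mulrC.
have [q0|q0] := eqVneq q.[0] 0.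
  by rewrite q0 normr0 mulr0 mulr_ge0 // slope_bound_ge0.
(* Up to the unimodular factor - tau z^m, [q] is its own reflection, so its extreme coefficients
   have equal modulus; hence its degree is exactly n. *)
have qn : `|q`_n| = `|q.[0]|.
  rewrite horner_coef0 /q !coefB !coefZ QE !coefZ !coef_conj_rev leqnn /= subnn subn0.
  rewrite -[LHS]norm_conjC rmorphB !rmorphM /= conjCK rmorphXn /=.
  rewrite (normf1_conj z1) (normf1_conj tau1) -[LHS]mul1r -[X in X * _](_ : `|- tau * z ^+ m| = 1).
    rewrite -normrM exprVn; congr `|_|; field; rewrite tau0 expf_neq0 //.
  by rewrite normrM normrN tau1 normrX z1 expr1n mulr1.
have qn0 : q`_n != 0 by rewrite -normr_eq0 qn normr_eq0.
have sQ : (size Q <= n.+1)%N by rewrite QE (leq_trans (size_scale_leq _ _)) // size_poly.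
have sq : (size q <= n.+1)%N.
  rewrite (leq_trans (size_polyD _ _)) // geq_max sQ size_polyN.
  by rewrite (leq_trans (size_scale_leq _ _)).
have sqE : size q = n.+1.
  apply/eqP; rewrite eqn_leq sq ltnNge; apply: contra qn0 => sqn.
  by rewrite nth_default.
have [ws qE] := closed_field_poly_normal q.
have lq0 : lead_coef q != 0 by rewrite lead_coefE sqE.
have sws : size ws = n.
  by have := sqE; rewrite qE size_scale // size_prod_XsubC => -[].
have rq v : root q v = (v \in ws) by rewrite qE rootZ // root_prod_XsubC.
have wws : w \in ws.
  rewrite -rq /root /q hornerD hornerN hornerZ tauE divfK ?subrr //.
have n0 : (0 < n)%N by rewrite -sws; case: (ws) wws.
have ws1 v : v \in ws -> `|v| = 1.
  move=> vws; have [rs [c0 E srs _]] := slice_roots sp' z1.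
  rewrite deg1_swap -/n in srs.
  have v0 : v != 0.
    by apply: contraNneq q0 => v0; have := vws; rewrite -rq v0.
  move=> rs1; apply: (unimodular_level srs n0 c0 _ v0).
    by apply: rs1 => x x1; rewrite -swE pT.
  rewrite -E -sliceE.
  have : `|Q.[v]| = `|P.[v]|.
    move: vws; rewrite -rq /root /q hornerD hornerN hornerZ subr_eq0 => /eqP->.
    by rewrite normrM tau1 mul1r.
  by rewrite QE hornerZ normrM normrX z1 expr1n mul1r.
have Pv v : v \in ws -> P.[v] != 0 by move=> /ws1 /pT.
have tauv v : v \in ws -> tau = Q.[v] / P.[v].
  move=> vws; have := vws; rewrite -rq /root /q hornerD hornerN hornerZ subr_eq0.
  by move=> /eqP->; rewrite mulfK // Pv.
have Qv v : v \in ws -> Q.[v] != 0.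
  by move=> vws; apply: contraNneq tau0 => Qv0; rewrite (tauv v) // Qv0 mul0r.
have T2_gt0 v : v \in ws -> 0 < angular n P v.
  move=> vws; rewrite /P sliceE /n -deg1_swap.
  apply: angular_gt0 sp' (ws1 v vws) z1 _ _; first by rewrite deg1_swap.
  by move=> x x1; rewrite -swE pT.
have T1_ge0 v : v \in ws -> 0 <= angular m (slice v p) z.
  by move=> vws; apply: angular_ge0 sp z1 (ws1 v vws) (Pv v vws).
have dq v : v \in ws -> v * q^`().[v] = Q.[v] * angular n P v.
  move=> vws; rewrite -(angular_logderiv (ws1 v vws) sP (Pv v vws) QE).
  by rewrite -tauv // /q derivB derivZ hornerD hornerN hornerZ.
(* Chosen so that r(v) / (v q'(v)) is the quotient of the two angular derivatives at each root v. *)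
pose r := z *: ((reflection p)^`().[z%:P] - tau *: p^`().[z%:P]).
have rv v : v \in ws -> r.[v] = Q.[v] * angular m (slice v p) z.
  move=> vws; have v1 := ws1 v vws.
  have := angular_logderiv z1 (size_slice v p) _ (slice_reflection p v1).
  rewrite !deriv_slice !horner_slice -/m -/P -/Q -tauv // => <-; last exact: Pv.
  by rewrite /r hornerZ hornerD hornerN hornerZ.
have uws : uniq ws.
  apply: uniq_roots_deriv => v vws.
  have : v * q^`().[v] != 0 by rewrite dq // mulf_neq0 ?Qv // lt0r_neq0 // T2_gt0.
  by rewrite qE derivZ hornerZ !mulf_eq0 !negb_or => /and3P[].
have size_eval u (N : nat) : (forall i, (size (u`_i)%R <= N)%N) -> (size u.[z%:P] <= N)%N.
  move=> uN; rewrite horner_coef (leq_trans (size_sum _ _ _)) //.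
  apply/bigmax_leqP => i _; rewrite -polyC_exp mulrC mul_polyC.
  exact: leq_trans (size_scale_leq _ _) (uN _).
have size_deriv u : (forall i, (size (u`_i)%R <= n.+1)%N) -> (size u^`().[z%:P] <= n.+1)%N.
  move=> un; apply: size_eval => i; rewrite coef_deriv -scaler_nat.
  exact: leq_trans (size_scale_leq _ _) (un _).
have sr : (size r <= n.+1)%N.
  rewrite (leq_trans (size_scale_leq _ _)) // (leq_trans (size_polyD _ _)) // geq_max.
  rewrite size_polyN (leq_trans (size_scale_leq _ _)) ?size_deriv //.
  - by move=> i; rewrite coef_poly; case: ifP => _; rewrite ?size_poly0 // size_poly.
  - by move=> i; rewrite (leq_trans (max_size_coefXY _ _)) // leqSpred.
have rk k : `|r`_k| <= coef_bound (reflection p)^`() k + coef_bound p^`() k.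
  rewrite /r coefZ coefB coefZ normrM z1 mul1r (le_trans (ler_normB _ _)) //.
  by rewrite lerD ?coef_boundP // normrM tau1 mul1r coef_boundP.
have aq : all (root q) ws by apply/allP => v; rewrite rq.
have := lagrange_at0 uws sws sq sr qn0 aq q0.
rewrite big_seq; under eq_bigr => v vws.
  rewrite rv // dq // -mulf_div divff ?Qv // mul1r; over.
rewrite -big_seq => E.
have T2w := T2_gt0 w wws.
(* All terms of the sum are nonnegative, so the term of [w] is at most the sum. *)
have : angular m (slice w p) z / angular n P w <= `|r`_n / q`_n - r.[0] / q.[0]|.
  rewrite E ger0_norm; last first.
    by rewrite big_seq sumr_ge0 // => v vws; rewrite divr_ge0 ?T1_ge0 // ltW ?T2_gt0.
  rewrite (bigD1_seq w) //= lerDl big_seq_cond sumr_ge0 // => v /andP[vws _].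
  by rewrite divr_ge0 ?T1_ge0 // ltW ?T2_gt0.
rewrite ler_pdivrMr // => /le_trans le_T1.
rewrite -ler_pdivlMr ?normr_gt0 //; apply: le_T1; rewrite mulrAC ler_wpM2r //.
rewrite (le_trans (ler_normB _ _)) // !normrM !normfV qn -mulrDl.
rewrite ler_wpM2r ?invr_ge0 // /slope_bound big_cons big_seq1 addrC lerD //.
by rewrite horner_coef0.
Qed.
End Reflection.

(** * Integrals over intervals *)

Section IntervalIntegrals.
Variable R : realType.
Implicit Types (f F dF : R -> R) (a b x y s : R).
Local Notation mu := (@lebesgue_measure R).

Lemma derive_continuous F dF : (forall x, is_derive x 1 F (dF x)) -> continuous F.
Proof. by move=> FdF x; apply: differentiable_continuous; apply/derivable1_diffP. Qed.

Lemma integral_derive F dF a b : a < b -> (forall x, is_derive x 1 F (dF x)) ->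
  continuous dF -> (\int[mu]_(x in `[a, b]) (dF x)%:E = (F b - F a)%:E)%E.
Proof.
move=> ab FdF cdF; have cF := derive_continuous FdF; rewrite EFinB.
apply: continuous_FTC2 => //.
- exact: continuous_subspaceT.
- split=> [x _||]; first exact: ex_derive.
  + exact/cvg_at_right_filter/cF.
  + exact/cvg_at_left_filter/cF.
- by move=> x _; rewrite derive1E; apply: derive_val.
Qed.

Lemma integrable_itv f a b : continuous f -> mu.-integrable `[a, b] (EFin \o f).
Proof.
move=> cf; apply: continuous_compact_integrable; first exact: segment_compact.
exact: continuous_subspaceT.
Qed.

Lemma ge_integral_derive f F dF a b : a < b -> (forall x, is_derive x 1 F (dF x)) ->
  continuous dF -> measurable_fun `[a, b] f ->
  {in `[a, b], forall x, 0 <= f x} ->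
  {in `[a, b], forall x, x != 0 -> dF x <= f x} ->
  ((F b - F a)%:E <= \int[mu]_(x in `[a, b]) (f x)%:E)%E.
Proof.
move=> ab FdF cdF mf f0 dFf; rewrite -(integral_derive ab FdF cdF).
(* The positive part of [dF]: the almost everywhere comparison is one of nonnegative functions. *)
pose G x := Num.max (dF x) 0.
have cG : continuous G by move=> x; apply: continuous_max; [exact: cdF|exact: cst_continuous].
apply: (@le_trans _ _ (\int[mu]_(x in `[a, b]) (G x)%:E)%E).
  apply: le_integral => //; [exact: integrable_itv|exact: integrable_itv|].
  by move=> x _; rewrite lee_fin le_max lexx.
apply: ae_ge0_le_integral => //.
- by move=> x _; rewrite lee_fin le_max lexx orbT.
- apply/measurable_EFinP; apply: measurable_funS (measurableT) _ _ => //.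
  exact: continuous_measurable_fun.
- exact/measurable_EFinP.
exists [set 0]; split=> //; first exact: lebesgue_measure_set1.
move=> x /= nx; apply: contrapT => x0; apply: nx => xab.
rewrite lee_fin ge_max f0 // dFf //; exact/eqP.
Qed.

Lemma le_integral_derive f F dF a b : a < b -> (forall x, is_derive x 1 F (dF x)) ->
  continuous dF -> measurable_fun `[a, b] f ->
  {in `[a, b], forall x, 0 <= f x <= dF x} ->
  (\int[mu]_(x in `[a, b]) (f x)%:E <= (F b - F a)%:E)%E.
Proof.
move=> ab FdF cdF mf fdF; rewrite -(integral_derive ab FdF cdF).
apply: ge0_le_integral => //.
- by move=> x xab; rewrite lee_fin; case/andP: (fdF x xab).
- exact/measurable_EFinP.
- apply/measurable_EFinP; apply: measurable_funS (measurableT) _ _ => //.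
  exact: continuous_measurable_fun.
- by move=> x xab; rewrite lee_fin; case/andP: (fdF x xab).
Qed.

(** For x > k, x^s = x^(s-1) x >= k^(s-1) (x - k). The affine minorant replaces Jensen's inequality:
    a lower bound for an integral becomes one for the integral of the power. *)
Lemma powR_ge_affine s k x : 1 <= s -> 0 < k -> 0 <= x ->
  k `^ (s - 1) * (x - k) <= x `^ s.
Proof.
move=> s1 k0 x0; have s0 : 0 <= s - 1 by rewrite subr_ge0.
have [xk|kx] := leP x k.
  by rewrite (@le_trans _ _ 0) ?powR_ge0 // mulr_ge0_le0 ?powR_ge0 ?subr_le0.
rewrite -(@mulr_powRB1 _ x s) ?(lt_le_trans ltr01) // mulrC.
by rewrite ler_pM ?powR_ge0 ?subr_ge0 ?(ltW kx) ?gerBl ?(ltW k0) // ge0_ler_powR ?nnegrE // ltW.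
Qed.

Lemma powR_le_linear s k x : 1 <= s -> 0 <= x <= k -> x `^ s <= k `^ (s - 1) * x.
Proof.
move=> s1 /andP[x0 xk]; rewrite -(@mulr_powRB1 _ x s) ?(lt_le_trans ltr01) // mulrC.
by rewrite ler_wpM2r // ge0_ler_powR ?nnegrE ?subr_ge0 // (le_trans x0).
Qed.

Lemma powRD_le s x y : 0 <= s -> 0 <= x -> 0 <= y ->
  (x + y) `^ s <= 2 `^ s * (x `^ s + y `^ s).
Proof.
move=> s0 x0 y0; wlog xy : x y x0 y0 / x <= y.
  by move=> H; have [/H->//|/ltW/H] := leP x y; rewrite addrC [_ `^ _ + _]addrC => ->.
apply: (@le_trans _ _ ((2 * y) `^ s)).
  by rewrite ge0_ler_powR ?nnegrE ?addr_ge0 ?mulr_ge0 //; lra.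
by rewrite powRM // ler_wpM2l ?powR_ge0 // lerDr powR_ge0.
Qed.

Lemma powR_sum_le (I : eqType) (r : seq I) (g : I -> R) s x : 0 <= s -> 0 <= x ->
  {in r, forall i, 0 <= g i} ->
  (x + \sum_(i <- r) g i) `^ s <= (2 `^ s) ^+ size r * (x `^ s + \sum_(i <- r) g i `^ s).
Proof.
move=> s0; elim: r x => [|i r IH] x x0 g0 /=.
  by rewrite !big_nil !addr0 mul1r.
have gi : 0 <= g i by rewrite g0 ?mem_head.
have g0' : {in r, forall j, 0 <= g j} by move=> j jr; rewrite g0 // inE jr orbT.
rewrite !big_cons addrCA; apply: le_trans (powRD_le s0 gi _) _.
  by rewrite addr_ge0 // big_seq sumr_ge0.
rewrite exprS -mulrA ler_wpM2l ?powR_ge0 // addrCA mulrDr lerD //; last exact: IH.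
have two1 : 1 <= 2 `^ s by have := ler_powR (ler1n R 2) s0; rewrite powRr0.
by rewrite ler_peMl ?powR_ge0 // exprn_ege1.
Qed.

Lemma cosB1_le x : 1 - x ^+ 2 / 2 <= cos x.
Proof.
wlog x0 : x / 0 < x.
  move=> H; have [/H//|x0|<-] := ltgtP 0 x; last by rewrite cos0 expr0n mul0r subr0.
  by rewrite -cosN -[x in x ^+ 2]opprK sqrrN H // oppr_gt0.
have sin_le y : 0 < y -> sin y <= y.
  move=> y0; have [|c _] := @MVT _ (fun t => t - sin t) (fun t => 1 - cos t) 0 y y0.
    by apply: continuous_subspaceT => t; apply: cvgB; [exact: cvg_id|exact: continuous_sin].
  rewrite sin0 !subr0 => E; rewrite -subr_ge0 E mulr_ge0 ?subr_ge0 ?cos_le1 //.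
  exact: ltW.
have [||c] := @MVT _ (fun t => cos t + t ^+ 2 / 2) (fun t => - sin t + t) 0 x x0.
- move=> t _; apply: is_deriveD; apply: is_derive_eq.
  by rewrite /GRing.scale /=; field.
- apply: continuous_subspaceT => t; apply: cvgD; first exact: continuous_cos.
  by apply: cvgM; [exact: exprn_continuous|exact: cvg_cst].
rewrite in_itv /= => /andP[c0 cx]; rewrite cos0 expr0n mul0r addr0 subr0 => E.
have : 0 <= cos x + x ^+ 2 / 2 - 1.
  by rewrite E mulr_ge0 ?(ltW x0) // addrC subr_ge0 sin_le.
by lra.
Qed.

Lemma cosB1_ge x : `|x| <= 1 -> cos x <= 1 - x ^+ 2 / 4.
Proof.
wlog x0 : x / 0 < x.
  move=> H; have [/H//|x0|<-] := ltgtP 0 x; last by rewrite cos0 expr0n mul0r subr0.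
  by rewrite -normrN => xN; rewrite -cosN -[x in x ^+ 2]opprK sqrrN H // oppr_gt0.
rewrite gtr0_norm // => x1.
have le_sin y : 0 < y -> y <= 1 -> y / 2 <= sin y.
  move=> y0 y1.
  have [||c] := @MVT _ (fun t => sin t - t / 2) (fun t => cos t - 1 / 2) 0 y y0.
  - move=> t _; apply: is_deriveB; apply: is_derive_eq.
    by rewrite /GRing.scale /=; field.
  - apply: continuous_subspaceT => t; apply: cvgB; first exact: continuous_sin.
    by apply: cvgM; [exact: cvg_id|exact: cvg_cst].
  rewrite in_itv /= sin0 mul0r !subr0 => /andP[c0 cy] E; rewrite -subr_ge0 E.
  rewrite mulr_ge0 ?(ltW y0) //; have := cosB1_le c; nra.
have [||c] := @MVT _ (fun t => - cos t - t ^+ 2 / 4) (fun t => sin t - t / 2) 0 x x0.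
- move=> t _; apply: is_deriveB; apply: is_derive_eq; first by rewrite opprK.
  by rewrite /GRing.scale /=; field.
- apply: continuous_subspaceT => t; apply: cvgB.
    by apply: cvgN; exact: continuous_cos.
  by apply: cvgM; [exact: exprn_continuous|exact: cvg_cst].
rewrite in_itv /= => /andP[c0 cx]; rewrite cos0 expr0n mul0r !subr0 => E.
have : 0 <= - cos x - x ^+ 2 / 4 - - 1.
  rewrite E mulr_ge0 ?(ltW x0) // subr_ge0 le_sin //.
  by rewrite (le_trans (ltW cx)).
by lra.
Qed.
End IntervalIntegrals.

(** * ** The integral inequality on one slice *)

Section SliceBound.
Variable R : realType.
Implicit Types (a d s x B : R) (th u v psi : R -> R).
Local Notation mu := (@lebesgue_measure R).

(* On an interval of half-length [d] where the angular derivative [th] of the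
   unimodular function [u + i v] is at least [2 / d * (1 - ((x - c) / d) ^ 2)],
   the values [u + i v] cannot all be close to [l1 + i l2]: the primitive
   [l1 * v - l2 * u] of [th * (l1 * u + l2 * v)] is bounded by [l], whereas
   [th] has integral at least [8 / 3]. *)
Lemma winding_lower_bound s c d B th u v psi l1 l2 : 1 <= s -> 0 < d -> 0 < B ->
  continuous th ->
  (forall x, is_derive x 1 u (- (th x * v x))) ->
  (forall x, is_derive x 1 v (th x * u x)) ->
  (forall x, u x ^+ 2 + v x ^+ 2 = 1) ->
  measurable_fun `[c - d, c + d] psi ->
  {in `[c - d, c + d], forall x, 0 <= psi x} ->
  {in `[c - d, c + d], forall x, 2 / d * (1 - ((x - c) / d) ^+ 2) <= th x} ->
  {in `[c - d, c + d], forall x, x != 0 ->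
    th x * (15 / 16 + l1 ^+ 2 + l2 ^+ 2 - 2 * (l1 * u x + l2 * v x)) <= B * psi x} ->
  (((4 * d * B)^-1 `^ (s - 1) / (2 * B))%:E <=
    \int[mu]_(x in `[(c - d)%R, (c + d)%R]) (psi x `^ s)%:E)%E.
Proof.
move=> s1 d0 B0 cth du dv uv mpsi psi0 thd thB.
(* Chosen so that B k (2 d) = 1/2, the total cost of the constant term of the affine minorant. *)
set k := (4 * d * B)^-1; have k0 : 0 < k by rewrite invr_gt0 !mulr_gt0.
set K := k `^ (s - 1); have K0 : 0 <= K by exact: powR_ge0.
(* As u^2 + v^2 = 1, L - 2 (l1 u + l2 v) is the squared distance from u + i v to l1 + i l2, minus
   1/16. *)
set L := 15 / 16 + l1 ^+ 2 + l2 ^+ 2.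
have L0 : 0 <= L by rewrite !addr_ge0 ?sqr_ge0 //; lra.
pose g x := 2 / d * (1 - ((x - c) / d) ^+ 2).
pose G x := 2 * ((x - c) / d - ((x - c) / d) ^+ 3 / 3).
pose h x := th x * (l1 * u x + l2 * v x).
pose H x := l1 * v x - l2 * u x.
have dG x : is_derive x 1 G (g x).
  rewrite /G /g; apply: is_derive_eq.
  rewrite /GRing.scale /= /GRing.scale /=; field.
  by rewrite gt_eqF.
have dH x : is_derive x 1 H (h x).
  by rewrite /H /h; apply: is_derive_eq; rewrite /GRing.scale /=; ring.
have cu : continuous u := derive_continuous du.
have cv : continuous v := derive_continuous dv.
(* A primitive of a minorant of psi^s: [th] is replaced by its lower bound [g] in the product with L
   >= 0 and kept in [h]. *)
pose F x := K / B * (L * G x - 2 * H x - B * k * x).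
pose dF x := K / B * (L * g x - 2 * h x - B * k).
have FdF x : is_derive x 1 F (dF x).
  have := dG x; have := dH x => ??; rewrite /F /dF; apply: is_derive_eq.
  by rewrite /GRing.scale /=; ring.
have cg : continuous g.
  move=> x; apply: cvgM; first exact: cvg_cst.
  apply: cvgB; first exact: cvg_cst.
  apply: (@continuous_comp _ _ _ (fun x => (x - c) / d) (fun y => y ^+ 2)).
    apply: cvgM; last exact: cvg_cst.
    by apply: cvgB; [exact: cvg_id|exact: cvg_cst].
  exact: exprn_continuous.
have cdF : continuous dF.
  move=> x; apply: cvgM; first exact: cvg_cst.
  apply: cvgB; last exact: cvg_cst.
  apply: cvgB; apply: cvgM; try exact: cvg_cst; first exact: cg.
  apply: cvgM; first exact: cth.
  by apply: cvgD; apply: cvgM; try exact: cvg_cst; [exact: cu|exact: cv].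
have cdcd : c - d < c + d by lra.
apply: (@le_trans _ _ (F (c + d) - F (c - d))%:E).
  have Hb x : H x ^+ 2 <= l1 ^+ 2 + l2 ^+ 2.
    have := uv x; rewrite /H; set p := u x; set q := v x => pq.
    have E : (l1 * q - l2 * p) ^+ 2 + (l1 * p + l2 * q) ^+ 2 =
             (l1 ^+ 2 + l2 ^+ 2) * (p ^+ 2 + q ^+ 2) by ring.
    by rewrite pq mulr1 in E; rewrite -E lerDl sqr_ge0.
  rewrite lee_fin /F /G.
  have -> : c + d - c = d by ring.
  have -> : c - d - c = - d by ring.
  rewrite mulNr divff ?gt_eqF // -mulrBr.
  have -> : L * (2 * (1 - 1 ^+ 3 / 3)) - 2 * H (c + d) - B * k * (c + d) -
     (L * (2 * (- 1 - (- 1) ^+ 3 / 3)) - 2 * H (c - d) - B * k * (c - d)) =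
     L * (8 / 3) - 2 * (H (c + d) - H (c - d)) - B * k * (2 * d) by field.
  have -> : B * k * (2 * d) = 1 / 2.
    by rewrite /k; field; rewrite !gt_eqF.
  have -> : K / (2 * B) = K / B * (1 / 2) by field; rewrite gt_eqF.
  rewrite ler_wpM2l ?divr_ge0 ?(ltW B0) //.
  (* With X and Y the two end values of [H], whose squares are at most l1^2 + l2^2, the difference
     of the two sides is at least 4/3 ((X - 3/4)^2 + (Y + 3/4)^2); the constant 15/16 is just large
     enough for this. *)
  have H1 := Hb (c + d); have H2 := Hb (c - d).
  rewrite /L; move: H1 H2; set X := H (c + d); set Y := H (c - d).
  move=> H1 H2.
  have : 0 <= X ^+ 2 - 3 / 2 * X + 9 / 16.
    have -> : X ^+ 2 - 3 / 2 * X + 9 / 16 = (X - 3 / 4) ^+ 2 by field.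
    exact: sqr_ge0.
  have : 0 <= Y ^+ 2 + 3 / 2 * Y + 9 / 16.
    have -> : Y ^+ 2 + 3 / 2 * Y + 9 / 16 = (Y + 3 / 4) ^+ 2 by field.
    exact: sqr_ge0.
  lra.
apply: (@ge_integral_derive _ _ F dF) => //.
- exact: (measurableT_comp (@measurable_powR R s) mpsi).
- by move=> x _; exact: powR_ge0.
move=> x xJ x0; apply: le_trans (powR_ge_affine s1 k0 (psi0 x xJ)).
rewrite /dF -/K -mulrA ler_wpM2l // ler_pdivrMl // mulrBr lerD2r.
apply: le_trans (thB x xJ x0); rewrite -/L mulrBr /h mulrCA.
have -> : th x * (2 * (l1 * u x + l2 * v x)) = 2 * th x * (l1 * u x + l2 * v x) by ring.
have -> : 2 * (th x * (l1 * u x + l2 * v x)) = 2 * th x * (l1 * u x + l2 * v x) by ring.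
by rewrite lerD2r mulrCA [leRHS]mulrC ler_wpM2l // thd.
Qed.

(** Each summand is the derivative of 6 atan((x - c) / d), whose total increase is at most 6 pi
    whatever the width d. *)
Lemma atan_sum_derive (r : seq (R * R)) a : 0 < a -> {in r, forall q, 0 < q.2} ->
  exists F dF : R -> R, [/\ forall x, is_derive x 1 F (dF x), continuous dF,
    forall x, dF x = \sum_(q <- r) 6 * q.2 / (q.2 ^+ 2 + (x - q.1) ^+ 2) &
    F a - F (- a) <= 6 * pi * (size r)%:R].
Proof.
move=> a0; elim: r => [|[c d] r IH] r0.
  exists (cst 0), (cst 0); split=> //.
  - by move=> x; apply: is_derive_cst.
  - exact: cst_continuous.
  - by move=> x; rewrite big_nil.
  - by rewrite /= subrr mulr0.
have [|F [dF [FdF cdF dFE Fa]]] := IH.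
  by move=> q qr; apply: r0; rewrite inE qr orbT.
have d0 : 0 < d := r0 _ (mem_head _ _).
have den x : 0 < d ^+ 2 + (x - c) ^+ 2.
  by rewrite ltr_pwDl ?sqr_ge0 ?exprn_gt0.
pose G x := 6 * atan ((x - c) / d).
pose dG x := 6 * d / (d ^+ 2 + (x - c) ^+ 2).
have GdG x : is_derive x 1 G (dG x).
  have dlin : is_derive x 1 (fun x : R => (x - c) / d) d^-1.
    by apply: is_derive_eq; rewrite /GRing.scale /=; ring.
  have datan := @is_derive1_comp R atan (fun x => (x - c) / d) x _ _
    (is_derive1_atan _) dlin.
  rewrite /G /dG; apply: is_derive_eq; rewrite /GRing.scale /=.
  by have dx := den x; field; rewrite !gt_eqF.
exists (fun x => G x + F x), (fun x => dG x + dF x); split.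
- by move=> x; apply: is_deriveD.
- move=> x; apply: cvgD; last exact: cdF.
  apply: cvgM; first exact: cvg_cst.
  apply: cvgV; first by rewrite gt_eqF.
  apply: cvgD; first exact: cvg_cst.
  apply: (@continuous_comp _ _ _ (fun x => x - c) (fun y => y ^+ 2)).
    by apply: cvgB; [exact: cvg_id|exact: cvg_cst].
  exact: exprn_continuous.
- by move=> x; rewrite big_cons dFE.
- rewrite /= opprD addrACA -[(size r).+1%:R]natr1 mulrDr mulr1 [leRHS]addrC lerD //.
  rewrite /G -mulrBr ler_pM2l //.
  have := atan_ltpi2 ((a - c) / d); have := atan_gtNpi2 ((- a - c) / d); lra.
Qed.

(** Neither this constant nor the next involves the poles, only a bound [m] on their number; this
    makes the inequality uniform over the slices. *)
Definition bound1 s a A (m : nat) : R := (2 `^ s) ^+ m * (A `^ s * (2 * a)).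
Definition bound2 s B (m : nat) : R :=
  (2 `^ s) ^+ m * ((24 * B) `^ (s - 1) * (2 * B) * (6 * pi * m%:R)).

(** A kernel of width d is at most 6 / d, so its power s has integral at most 6 pi (6 / d)^(s - 1).
    On the interval of the same pole [winding_lower_bound] makes the integral of psi^s at least a
    multiple of d^(1 - s), which absorbs this. *)
Lemma slice_bound s a A B (m : nat) th u v psi l1 l2 (r : seq (R * R)) :
  1 <= s -> 0 < a -> 0 <= A -> 0 < B -> (size r <= m)%N ->
  {in r, forall q, 0 < q.2 /\ `|q.1| + q.2 <= 8 * a} ->
  continuous th -> (forall x, 0 <= th x) ->
  (forall x, is_derive x 1 u (- (th x * v x))) ->
  (forall x, is_derive x 1 v (th x * u x)) ->
  (forall x, u x ^+ 2 + v x ^+ 2 = 1) ->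
  measurable_fun `[- (8 * a), 8 * a] psi ->
  {in `[- (8 * a), 8 * a], forall x, 0 <= psi x} ->
  {in `[- a, a], forall x,
     th x <= A + \sum_(q <- r) 6 * q.2 / (q.2 ^+ 2 + (x - q.1) ^+ 2)} ->
  {in r, forall q, {in `[q.1 - q.2, q.1 + q.2], forall x,
     2 / q.2 * (1 - ((x - q.1) / q.2) ^+ 2) <= th x}} ->
  {in `[- (8 * a), 8 * a], forall x, x != 0 ->
    th x * (15 / 16 + l1 ^+ 2 + l2 ^+ 2 - 2 * (l1 * u x + l2 * v x)) <= B * psi x} ->
  (\int[mu]_(x in `[(- a)%R, a]) (th x `^ s)%:E <=
   (bound1 s a A m)%:E +
   (bound2 s B m)%:E * \int[mu]_(x in `[(- (8 * a))%R, (8 * a)%R]) (psi x `^ s)%:E)%E.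
Proof.
move=> s1 a0 A0 B0 srm r8 cth th0 du dv uv mpsi psi0 thA thd thB.
have s0 : 0 <= s by rewrite (le_trans ler01).
have a0' : 0 <= a by apply: ltW.
set I2 := (\int[mu]_(x in _) (psi x `^ s)%:E)%E.
have two_s : 1 <= 2 `^ s by have := ler_powR (ler1n R 2) s0; rewrite powRr0.
have I2_ge0 : (0 <= I2)%E by apply: integral_ge0 => x _; rewrite lee_fin powR_ge0.
have b1 : 0 <= bound1 s a A m.
  by rewrite !mulr_ge0 ?exprn_ge0 ?powR_ge0.
have low q : q \in r -> (((4 * q.2 * B)^-1 `^ (s - 1) / (2 * B))%:E <= I2)%E.
  move=> qr; have [q0 q8] := r8 q qr.
  have sub : `[q.1 - q.2, q.1 + q.2]%classic `<=` `[- (8 * a), 8 * a]%classic.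
    move=> x /=; rewrite !in_itv /= => /andP[x1 x2].
    have := ler_norm q.1; have := ler_norm (- q.1); rewrite normrN => ??.
    by apply/andP; split; lra.
  have subi x : x \in `[q.1 - q.2, q.1 + q.2] -> x \in `[- (8 * a), 8 * a] by exact: sub.
  apply: le_trans (_ : _ <= \int[mu]_(x in `[(q.1 - q.2)%R, (q.1 + q.2)%R]) (psi x `^ s)%:E)%E _.
    apply: (@winding_lower_bound _ _ _ _ th u v psi l1 l2) => //.
    - exact: measurable_funS mpsi.
    - by move=> x /subi; apply: psi0.
    - exact: thd.
    - by move=> x /subi; apply: thB.
  apply: ge0_subset_integral => //.
  - apply/measurable_EFinP; exact: (measurableT_comp (@measurable_powR R s) mpsi).
  - by move=> x _; rewrite lee_fin powR_ge0.
(* With no poles [th] is at most A. This case is apart because [m] may be 0, while otherwise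
   [bound2] is positive and an infinite integral of psi^s makes the right side infinite. *)
have [r0|rn0] := eqVneq r [::].
  apply: (@le_trans _ _ (bound1 s a A m)%:E); last first.
    by rewrite leeDl // mule_ge0 // lee_fin !mulr_ge0 ?exprn_ge0 ?powR_ge0 ?pi_ge0 ?(ltW B0).
  have -> : bound1 s a A m = (fun x => (2 `^ s) ^+ m * A `^ s * x) a
     - (fun x => (2 `^ s) ^+ m * A `^ s * x) (- a) by rewrite /bound1 /=; ring.
  apply: (@le_integral_derive _ _ _ (cst ((2 `^ s) ^+ m * A `^ s))) => //.
  - by lra.
  - by move=> x; apply: is_derive_eq; rewrite /GRing.scale /=; ring.
  - exact: cst_continuous.
  - apply: measurable_funS (measurableT) _ _ => //.
    apply: (measurableT_comp (@measurable_powR R s)).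
    exact: continuous_measurable_fun.
  - move=> x xa; rewrite powR_ge0 /=; have := thA x xa; rewrite r0 big_nil addr0 => thxA.
    apply: (@le_trans _ _ (A `^ s)); first by rewrite ge0_ler_powR ?nnegrE.
    by rewrite ler_peMl ?powR_ge0 // exprn_ege1.
have [i2 I2E] : exists i2, I2 = i2%:E \/ I2 = +oo%E.
  by case: I2 I2_ge0 {low} => [i2||] // _; [exists i2; left|exists 0; right].
have m0 : (0 < m)%N by apply: leq_trans srm; case: (r) rn0.
have b2 : 0 < bound2 s B m.
  by rewrite !mulr_gt0 ?exprn_gt0 ?powR_gt0 ?pi_gt0 ?mulr_gt0 ?ltr0n.
case: I2E => I2E; last by rewrite I2E gt0_muley ?lte_fin // addey // leey.
rewrite I2E -EFinM -EFinD.
have i2_ge0 : 0 <= i2 by rewrite -lee_fin -I2E.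
have r_gt0 : {in r, forall q, 0 < q.2} by move=> q /r8[].
have [F [dF [FdF cdF dFE Fa]]] := atan_sum_derive a0 r_gt0.
pose M := (24 * B) `^ (s - 1) * (2 * B) * i2.
have M0 : 0 <= M by rewrite !mulr_ge0 ?powR_ge0 // ltW.
pose D := (2 `^ s) ^+ m; have D0 : 0 <= D by rewrite exprn_ge0 ?powR_ge0.
pose P x := D * (A `^ s * x + M * F x).
pose dP x := D * (A `^ s + M * dF x).
apply: (@le_trans _ _ (P a - P (- a))%:E); last first.
  rewrite lee_fin.
  have -> : P a - P (- a) = D * (A `^ s * (2 * a) + M * (F a - F (- a))).
    by rewrite /P; ring.
  have -> : bound1 s a A m + bound2 s B m * i2 =
      D * (A `^ s * (2 * a) + M * (6 * pi * m%:R)).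
    by rewrite /bound1 /bound2 /M /D; ring.
  rewrite ler_wpM2l // lerD2l ler_wpM2l // (le_trans Fa) //.
  by rewrite ler_wpM2l ?mulr_ge0 ?pi_ge0 ?ler_nat.
apply: (@le_integral_derive _ _ _ dP) => //.
- by lra.
- by move=> x; have := FdF x => ?; rewrite /P /dP; apply: is_derive_eq; rewrite /GRing.scale /=; ring.
- move=> x; apply: cvgM; first exact: cvg_cst.
  apply: cvgD; first exact: cvg_cst.
  by apply: cvgM; [exact: cvg_cst|exact: cdF].
- apply: measurable_funS (measurableT) _ _ => //.
  apply: (measurableT_comp (@measurable_powR R s)).
  exact: continuous_measurable_fun.
move=> x xa; rewrite powR_ge0 /=.
have term0 : {in r, forall q, 0 <= 6 * q.2 / (q.2 ^+ 2 + (x - q.1) ^+ 2)}.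
  by move=> q /r_gt0 q0; rewrite divr_ge0 ?mulr_ge0 ?addr_ge0 ?sqr_ge0 // ltW.
apply: (@le_trans _ _ ((A + \sum_(q <- r) 6 * q.2 / (q.2 ^+ 2 + (x - q.1) ^+ 2)) `^ s)).
  rewrite ge0_ler_powR ?nnegrE ?thA // addr_ge0 // big_seq sumr_ge0 //.
apply: le_trans (powR_sum_le s0 A0 term0) _.
have sum0 : 0 <= \sum_(i <- r) (6 * i.2 / (i.2 ^+ 2 + (x - i.1) ^+ 2)) `^ s.
  by rewrite sumr_ge0 // => q _; rewrite powR_ge0.
rewrite /dP /D; apply: (@le_trans _ _ ((2 `^ s) ^+ m *
  (A `^ s + \sum_(i <- r) (6 * i.2 / (i.2 ^+ 2 + (x - i.1) ^+ 2)) `^ s))).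
  by rewrite ler_wpM2r ?addr_ge0 ?powR_ge0 // ler_weXn2l.
rewrite ler_wpM2l // lerD2l dFE mulr_sumr !big_seq ler_sum // => q qr.
have q0 := r_gt0 q qr.
have q20 : 0 < q.2 ^+ 2 by rewrite exprn_gt0.
apply: (@le_trans _ _ ((6 / q.2) `^ (s - 1) * (6 * q.2 / (q.2 ^+ 2 + (x - q.1) ^+ 2)))).
  apply: powR_le_linear => //; rewrite term0 //=.
  have den : 0 < q.2 ^+ 2 + (x - q.1) ^+ 2 by rewrite ltr_pwDl ?sqr_ge0.
  rewrite ler_pdivrMr // mulrAC ler_pdivlMr // -!mulrA ler_pM2l //.
  by rewrite -expr2 lerDl sqr_ge0.
rewrite ler_wpM2r ?term0 // /M.
have := low q qr; rewrite I2E lee_fin => lowq.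
(* This exposes the constant (4 d B)^-1 of the lower bound [lowq]. *)
have -> : 6 / q.2 = 24 * B * (4 * q.2 * B)^-1.
  by field; rewrite !gt_eqF.
rewrite powRM ?invr_ge0 ?mulr_ge0 ?(ltW q0) ?(ltW B0) // -!mulrA.
rewrite ler_wpM2l ?powR_ge0 //.
by rewrite !mulrA [leRHS]mulrC -ler_pdivrMr ?mulr_gt0.
Qed.
End SliceBound.

(** * Functions on the circle *)

Section ComplexParts.
Variable R : realType.
Implicit Types (z w a : C R) (f g : R -> C R) (P Q : {poly C R}).
Local Notation re := (@complex.Re R).
Local Notation im := (@complex.Im R).
Local Notation "k %:C" := (real_complex R k : C R).

Lemma reD z w : re (z + w) = re z + re w. Proof. by case: z; case: w. Qed.
Lemma imD z w : im (z + w) = im z + im w. Proof. by case: z; case: w. Qed.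
Lemma reN z : re (- z) = - re z. Proof. by case: z. Qed.
Lemma imN z : im (- z) = - im z. Proof. by case: z. Qed.
Lemma reM z w : re (z * w) = re z * re w - im z * im w.
Proof. by case: z; case: w. Qed.
Lemma imM z w : im (z * w) = re z * im w + im z * re w.
Proof. by case: z; case: w. Qed.
Lemma reJ z : re z^* = re z. Proof. by case: z. Qed.
Lemma imJ z : im z^* = - im z. Proof. by case: z. Qed.

Lemma complex_ext z w : re z = re w -> im z = im w -> z = w.
Proof. by case: z => a b; case: w => c d /= -> ->. Qed.

Lemma cmodE z : cmod z = Num.sqrt (re z ^+ 2 + im z ^+ 2).
Proof. by rewrite /cmod normc_def. Qed.

Lemma normE z : `|z| = (cmod z)%:C.
Proof. by rewrite /cmod normc_def. Qed.

Lemma cmod_sq z : cmod z ^+ 2 = re z ^+ 2 + im z ^+ 2.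
Proof. by rewrite cmodE sqr_sqrtr // addr_ge0 ?sqr_ge0. Qed.

Lemma cmod_ge0 z : 0 <= cmod z. Proof. by rewrite cmodE sqrtr_ge0. Qed.

Lemma cmodD z w : cmod (z + w) <= cmod z + cmod w.
Proof. by rewrite -lecR -normE rmorphD /= -!normE ler_normD. Qed.

Lemma cmod_real k : 0 <= k -> cmod k%:C = k.
Proof. by move=> k0; rewrite cmodE /= expr0n addr0 sqrtr_sqr ger0_norm. Qed.

Lemma cmodN z : cmod (- z) = cmod z.
Proof. by rewrite /cmod normrN. Qed.

Lemma cmod_eq0 z : (cmod z == 0) = (z == 0).
Proof. by rewrite -[RHS]normr_eq0 normE -(inj_eq (@complexI R)). Qed.

Lemma cmod_gt0 z : (0 < cmod z) = (z != 0).
Proof. by rewrite lt_neqAle cmod_ge0 andbT eq_sym cmod_eq0. Qed.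

Lemma norm1_cmod z : (`|z| = 1) <-> (cmod z = 1).
Proof. by rewrite normE; split=> [/(@complexI R _ 1)|->]. Qed.

Lemma norm_gt1 z : (1 < `|z|) = (1 < cmod z).
Proof. by rewrite normE -ltcR rmorph1. Qed.

Lemma norm_lt1 z : (`|z| < 1) = (cmod z < 1).
Proof. by rewrite normE -ltcR rmorph1. Qed.

Lemma re_nat n : re n%:R = n%:R.
Proof. by elim: n => // n IH; rewrite -!natr1 reD IH. Qed.

Lemma re_le_cmod z : `|re z| <= cmod z.
Proof. by rewrite cmodE -sqrtr_sqr ler_wsqrtr // lerDl sqr_ge0. Qed.

Lemma im_le_cmod z : `|im z| <= cmod z.
Proof. by rewrite cmodE -sqrtr_sqr ler_wsqrtr // lerDr sqr_ge0. Qed.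

Lemma norm_expi t : `|expi t : C R| = 1.
Proof. by rewrite norm1_cmod cmodE /= cos2Dsin2 sqrtr1. Qed.

Lemma expi0 : expi (0 : R) = 1.
Proof. by rewrite /expi cos0 sin0. Qed.

(** The derivative of a plane curve in a real parameter, taken by components; [derive1] on [C R] is
    the complex derivative. *)
Definition is_cderive f (f' : C R) (x : R) : Prop :=
  is_derive x 1 (fun t => re (f t)) (re f') /\ is_derive x 1 (fun t => im (f t)) (im f').

Lemma is_cderive_eq f (f1 f2 : C R) x : is_cderive f f1 x -> f1 = f2 -> is_cderive f f2 x.
Proof. by move=> + <-. Qed.

Lemma is_cderive_cst z x : is_cderive (cst z) 0 x.
Proof. by split; exact: is_derive_cst. Qed.

Lemma is_cderiveD f g (f' g' : C R) x : is_cderive f f' x -> is_cderive g g' x ->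
  is_cderive (fun t => f t + g t) (f' + g') x.
Proof.
move=> [fr fi] [gr gi]; split.
- rewrite (_ : (fun t => _) = (fun t => re (f t)) + (fun t => re (g t))); last first.
    by apply/funext => t; rewrite reD.
  by rewrite reD; apply: is_deriveD.
- rewrite (_ : (fun t => _) = (fun t => im (f t)) + (fun t => im (g t))); last first.
    by apply/funext => t; rewrite imD.
  by rewrite imD; apply: is_deriveD.
Qed.

Lemma is_cderiveM f g (f' g' : C R) x : is_cderive f f' x -> is_cderive g g' x ->
  is_cderive (fun t => f t * g t) (f' * g x + f x * g') x.
Proof.
move=> [fr fi] [gr gi]; split.
- rewrite (_ : (fun t => _) = (fun t => re (f t)) * (fun t => re (g t)) -
      (fun t => im (f t)) * (fun t => im (g t))); last first.
    by apply/funext => t; rewrite reM.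
  apply: is_derive_eq (is_deriveB (is_deriveM fr gr) (is_deriveM fi gi)) _.
  by rewrite /GRing.scale /= reD !reM; ring.
- rewrite (_ : (fun t => _) = (fun t => re (f t)) * (fun t => im (g t)) +
      (fun t => im (f t)) * (fun t => re (g t))); last first.
    by apply/funext => t; rewrite imM.
  apply: is_derive_eq (is_deriveD (is_deriveM fr gi) (is_deriveM fi gr)) _.
  by rewrite /GRing.scale /= imD !imM; ring.
Qed.

Lemma is_cderiveJ f (f' : C R) x : is_cderive f f' x ->
  is_cderive (fun t => (f t)^*) f'^* x.
Proof.
move=> [fr fi]; split.
- rewrite (_ : (fun t => _) = (fun t => re (f t))) ?reJ //.
  by apply/funext => t; rewrite reJ.
- rewrite (_ : (fun t => _) = - (fun t => im (f t))); last first.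
    by apply/funext => t; rewrite imJ.
  by rewrite imJ; apply: is_deriveN.
Qed.

Lemma re2Dim2_neq0 z : z != 0 -> re z ^+ 2 + im z ^+ 2 != 0.
Proof. by move=> z0; rewrite -cmod_sq expf_neq0 // cmod_eq0. Qed.

(** The inverse is conj f divided by the real function N = |f|^2. *)
Lemma is_cderiveV f (f' : C R) x : f x != 0 -> is_cderive f f' x ->
  is_cderive (fun t => (f t)^-1) (- f' / f x ^+ 2) x.
Proof.
move=> fx0 df; have fx2 := re2Dim2_neq0 fx0.
pose N t := re (f t) ^+ 2 + im (f t) ^+ 2.
have dN : is_derive x 1 N (2 * (re (f x) * re f' + im (f x) * im f')).
  case: df => fr fi.
  by rewrite /N; apply: is_derive_eq; rewrite /GRing.scale /=; ring.
have dNV : is_derive x 1 (fun t => (N t)^-1)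
    (- (N x) ^- 2 * (2 * (re (f x) * re f' + im (f x) * im f'))).
  exact: is_deriveV.
have dg : is_cderive (fun t => (N t)^-1%:C)
    (- (N x) ^- 2 * (2 * (re (f x) * re f' + im (f x) * im f')))%:C x.
  by split=> //=; exact: is_derive_cst.
have NE t : (N t)%:C = f t * (f t)^*.
  by rewrite -normCK normE -rmorphXn /= cmod_sq.
rewrite (_ : (fun t => (f t)^-1) = (fun t => (f t)^* * (N t)^-1%:C)); last first.
  apply/funext => t; rewrite fmorphV /= NE invfM mulrCA.
  (* The identity holds at the zeros of [f] too, the inverse of 0 being 0. *)
  have [->|ft0] := eqVneq (f t) 0; first by rewrite invr0 mul0r.
  by rewrite mulfV ?conjC_eq0 ?mulr1.
apply: is_cderive_eq (is_cderiveM (is_cderiveJ df) dg) _.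
have fJ0 : (f x)^* != 0 by rewrite conjC_eq0.
have E2 : (2 * (re (f x) * re f' + im (f x) * im f'))%:C = f x * f'^* + (f x)^* * f'.
  apply: complex_ext; rewrite ?reD ?imD ?reM ?imM ?reJ ?imJ /=; ring.
rewrite rmorphM rmorphN !fmorphV rmorphXn /= E2 NE.
by field; rewrite fJ0 fx0.
Qed.

Definition ii : C R := (0 +i* 1)%C.

Lemma is_cderive_expi x : is_cderive (@expi R) (ii * expi x) x.
Proof.
split.
- rewrite reM /= mul0r mul1r sub0r; exact: is_derive_cos.
- rewrite imM /= mul0r mul1r add0r; exact: is_derive_sin.
Qed.

Lemma is_cderive_horner P x :
  is_cderive (fun t => P.[expi t]) (ii * expi x * P^`().[expi x]) x.
Proof.
elim/poly_ind: P => [|P c IH].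
  rewrite (_ : (fun t => _) = cst 0); last by apply/funext => t; rewrite horner0.
  by rewrite derivC horner0 mulr0; exact: is_cderive_cst.
rewrite (_ : (fun t => _) = (fun t => P.[expi t] * expi t + cst c t)); last first.
  by apply/funext => t; rewrite hornerMXaddC.
apply: is_cderive_eq (is_cderiveD (is_cderiveM IH (is_cderive_expi x)) (is_cderive_cst c x)) _.
by rewrite derivMXaddC hornerD hornerMX; ring.
Qed.

Lemma is_cderive_continuous f (f' : R -> C R) :
  (forall x, is_cderive f (f' x) x) ->
  continuous (fun x => re (f x)) /\ continuous (fun x => im (f x)).
Proof.
move=> df; split.
- by apply: (@derive_continuous _ _ (fun x => re (f' x))) => x; case: (df x).
- by apply: (@derive_continuous _ _ (fun x => im (f' x))) => x; case: (df x).
Qed.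

Lemma cmod_continuous (T : topologicalType) (f : T -> C R) :
  continuous (fun x => re (f x)) -> continuous (fun x => im (f x)) ->
  continuous (fun x => cmod (f x)).
Proof.
move=> cr ci.
rewrite (_ : (fun x => _) = Num.sqrt \o (fun x => re (f x) ^+ 2 + im (f x) ^+ 2)); last first.
  by apply/funext => x; rewrite cmodE.
move=> x; apply: continuous_comp; last exact: sqrt_continuous.
apply: cvgD; rewrite /=.
- by apply: (@continuous_comp _ _ _ (fun x => re (f x)) (fun y => y ^+ 2)); [exact: cr|exact: exprn_continuous].
- by apply: (@continuous_comp _ _ _ (fun x => im (f x)) (fun y => y ^+ 2)); [exact: ci|exact: exprn_continuous].
Qed.

(** The angle is atan(Im a / Re a), and |atan t| <= |t| by the mean value theorem. *)
Lemma expi_polar a : 1 < cmod a -> 0 < re a ->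
  exists c d, [/\ 0 < d, a = (1 + d)%:C * expi c, cmod a = 1 + d & `|c| <= `|im a| / re a].
Proof.
move=> a1 ra; pose t := im a / re a; exists (atan t), (cmod a - 1).
have cE : re a = cmod a * cos (atan t).
  rewrite cos_atan cmodE.
  have -> : re a ^+ 2 + im a ^+ 2 = re a ^+ 2 * (1 + t ^+ 2).
    by rewrite /t; field; rewrite gt_eqF.
  rewrite sqrtrM ?sqr_ge0 // sqrtr_sqr gtr0_norm // mulfK //.
  by rewrite sqrtr_eq0 -ltNge ltr_pwDl ?sqr_ge0.
have c0 : cos (atan t) != 0.
  by apply/eqP => c0; move: ra; rewrite cE c0 mulr0 ltxx.
have sE : im a = cmod a * sin (atan t).
  have : tan (atan t) = t := atanK t; rewrite /tan => /(canRL (divfK c0)) ->.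
  by rewrite mulrCA -cE /t divfK // gt_eqF.
have -> : 1 + (cmod a - 1) = cmod a by ring.
rewrite subr_gt0; split=> //.
  by apply: complex_ext; rewrite ?reM ?imM /= !mul0r ?subr0 ?addr0.
have atan_le y : 0 < y -> atan y <= y.
  move=> y0; have [|c _] := @MVT _ atan (fun x => (1 + x ^+ 2)^-1) 0 y y0.
    by apply: continuous_subspaceT => x; exact: continuous_atan.
  rewrite atan0 !subr0 => ->; rewrite ler_piMl ?(ltW y0) // invf_le1 ?lerDl ?sqr_ge0 //.
  by rewrite ltr_pwDl ?sqr_ge0.
have -> : `|im a| / re a = `|t| by rewrite normrM normfV (gtr0_norm ra).
have [t0|t0|->] := ltgtP t 0; last by rewrite atan0.
- rewrite -normrN -atanN -[leRHS]normrN.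
  have : 0 < - t by rewrite oppr_gt0.
  move: (- t) => y y0; rewrite (gtr0_norm y0) ger0_norm ?atan_le //.
  by rewrite -atan0 le_atan // ltW.
- by rewrite (gtr0_norm t0) ger0_norm ?atan_le // -atan0 le_atan // ltW.
Qed.

(** |a|^2 - 1 = d (2 + d), and the denominator is the law of cosines for |exp(i x) - a|^2. *)
Lemma poissonE x a c d : a = (1 + d)%:C * expi c -> 0 < d ->
  re (poisson (expi x) a) = d * (2 + d) / (d ^+ 2 + 2 * (1 + d) * (1 - cos (x - c))).
Proof.
move=> aE d0.
have -> : poisson (expi x) a =
    ((cmod a ^+ 2 - 1) / cmod (expi x - a) ^+ 2)%:C.
  rewrite /poisson !normE rmorphM fmorphV rmorphB !rmorphXn //=.
rewrite [LHS]/= !cmod_sq reD imD reN imN aE reM imM /= !mul0r subr0 addr0.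
rewrite cosB.
have Ec := cos2Dsin2 c; have Ex := cos2Dsin2 x.
congr (_ / _).
- rewrite !exprMn -mulrDr Ec; ring.
- have -> : (cos x - (1 + d) * cos c) ^+ 2 + (sin x - (1 + d) * sin c) ^+ 2 =
     (cos x ^+ 2 + sin x ^+ 2) + (1 + d) ^+ 2 * (cos c ^+ 2 + sin c ^+ 2)
      - 2 * (1 + d) * (cos x * cos c + sin x * sin c) by ring.
  rewrite Ec Ex; ring.
Qed.

(** The numerator is at most 3 d, and 1 - cos y >= y^2 / 4 makes the denominator at least (d^2 +
    y^2) / 2. *)
Lemma poisson_upper x a c d : a = (1 + d)%:C * expi c -> 0 < d -> d <= 1 ->
  `|x - c| <= 1 ->
  re (poisson (expi x) a) <= 6 * d / (d ^+ 2 + (x - c) ^+ 2).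
Proof.
move=> aE d0 d1 xc; rewrite (poissonE _ aE d0).
have := cosB1_ge xc; set k := cos (x - c); set y := x - c => kle.
have k1 : k <= 1 := cos_le1 _.
have y2 := sqr_ge0 y; have d2 : 0 < d ^+ 2 by rewrite exprn_gt0.
have lb : (d ^+ 2 + y ^+ 2) / 2 <= d ^+ 2 + 2 * (1 + d) * (1 - k) by nra.
have den : 0 < d ^+ 2 + y ^+ 2 by lra.
apply: (@le_trans _ _ (d * 3 / ((d ^+ 2 + y ^+ 2) / 2))).
  rewrite ler_pM ?mulr_ge0 ?invr_ge0 ?(ltW d0) //; first by lra.
  - by lra.
  - by rewrite ler_pM2l //; lra.
  - by rewrite lef_pV2 ?posrE //; lra.
by rewrite le_eqVlt; apply/orP; left; apply/eqP; field; rewrite gt_eqF.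
Qed.

(** The parabola vanishes at the ends of the interval and has an explicit primitive. By 1 - cos y <=
    y^2 / 2 the claim reduces to a polynomial inequality in d and t = y / d. *)
Lemma poisson_lower x a c d : a = (1 + d)%:C * expi c -> 0 < d ->
  `|x - c| <= d ->
  2 / d * (1 - ((x - c) / d) ^+ 2) <= re (poisson (expi x) a).
Proof.
move=> aE d0 xc; rewrite (poissonE _ aE d0).
have := cosB1_le (x - c); set k := cos (x - c); set y := x - c => kge.
have k1 : k <= 1 := cos_le1 _.
have d2 : 0 < d ^+ 2 by rewrite exprn_gt0.
have yd : y ^+ 2 <= d ^+ 2.
  by rewrite -(real_normK (num_real y)) ler_pXn2r ?nnegrE ?normr_ge0 // ltW.
have y2 := sqr_ge0 y.
have den : 0 < d ^+ 2 + 2 * (1 + d) * (1 - k) by rewrite ltr_pwDl ?mulr_ge0 //; lra.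
rewrite ler_pdivlMr //.
set t := y / d; have yE : y = d * t by rewrite /t mulrCA divff ?mulr1 // gt_eqF.
have t1 : t ^+ 2 <= 1.
  by rewrite -(ler_pM2l d2) mulr1 -exprMn -yE.
have t0 := sqr_ge0 t.
apply: (@le_trans _ _ (2 / d * (1 - t ^+ 2) * (d ^+ 2 + (1 + d) * (d * t) ^+ 2))).
  rewrite ler_wpM2l //; last by rewrite -yE; nra.
  by rewrite mulr_ge0 ?divr_ge0 ?(ltW d0) // subr_ge0.
have -> : 2 / d * (1 - t ^+ 2) * (d ^+ 2 + (1 + d) * (d * t) ^+ 2) =
   2 * d * (1 - t ^+ 2) * (1 + (1 + d) * t ^+ 2) by field; rewrite gt_eqF.
set s := t ^+ 2 in t0 t1 *; rewrite -subr_ge0.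
have -> : d * (2 + d) - 2 * d * (1 - s) * (1 + (1 + d) * s) =
  d ^+ 2 * ((1 - s) ^+ 2 + s ^+ 2) + 2 * d * s ^+ 2 by ring.
have d0' := ltW d0.
apply: addr_ge0; first by apply: mulr_ge0; [exact: sqr_ge0|apply: addr_ge0; exact: sqr_ge0].
by apply: mulr_ge0; [apply: mulr_ge0|exact: sqr_ge0].
Qed.
End ComplexParts.

(** * ** Partial derivatives of phi and the poles of its slices *)

Section InnerDerivative.
Variable R : realType.
Implicit Types (p u : {poly {poly C R}}) (z w a : C R).
Local Notation re := (@complex.Re R).
Local Notation im := (@complex.Im R).
Local Notation "k %:C" := (real_complex R k : C R).
Local Notation mu := (@lebesgue_measure R).

(** The quotient rule for the first partial derivative. Division by 0 being 0, it vanishes at the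
    zeros of [p], where nothing is claimed about [partial1]. *)
Definition dphi p z w : C R :=
  ((reflection p)^`().[z, w] * p.[z, w] - (reflection p).[z, w] * p^`().[z, w])
    / p.[z, w] ^+ 2.

Lemma is_derive_horner (P : {poly C R}) z :
  is_derive z (1 : C R) (horner P) P^`().[z].
Proof.
elim/poly_ind: P => [|P c IH].
  rewrite (_ : horner 0 = cst 0); last by apply/funext => v; rewrite horner0.
  by rewrite deriv0 horner0; exact: is_derive_cst.
rewrite (_ : horner (_ + _) = horner P * id + cst c); last first.
  by apply/funext => v; rewrite hornerMXaddC.
apply: is_derive_eq (is_deriveD (is_deriveM IH (is_derive_id z 1)) (is_derive_cst c z 1)) _.
by rewrite derivMXaddC hornerD hornerMX /GRing.scale /=; ring.
Qed.

Lemma partial1E p z w : p.[z, w] != 0 -> partial1 (phi p) (z, w) = dphi p z w.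
Proof.
move=> pzw; rewrite /partial1 /=.
rewrite (_ : (fun v => phi p (v, w)) =
    horner (slice w (reflection p)) * (fun v => (horner (slice w p) v)^-1)); last first.
  by apply/funext => v; rewrite /phi /quotient /= -!horner_slice.
have P0 : (slice w p).[z] != 0 by rewrite horner_slice.
have dV : derivable (fun v => (slice w p).[v]^-1) z 1.
  by apply: derivableV => //; case: (is_derive_horner (slice w p) z).
have [dQ EQ] := is_derive_horner (slice w (reflection p)) z.
have [dP EP] := is_derive_horner (slice w p) z.
rewrite derive1E (deriveM dQ dV) (deriveV P0 dP) EQ EP /GRing.scale /= !deriv_slice !horner_slice /dphi.
by field.
Qed.

Lemma phi_swap p z w : phi (swapXY p) (w, z) = phi p (z, w).
Proof. by rewrite /phi /quotient /= reflection_swap !horner2_swapXY. Qed.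

Lemma partial2E p z w : p.[z, w] != 0 ->
  partial2 (phi p) (z, w) = dphi (swapXY p) w z.
Proof.
move=> pzw; have pwz : (swapXY p).[w, z] != 0 by rewrite horner2_swapXY.
have E : (fun v => phi (swapXY p) (v, z)) = (fun v => phi p (z, v)).
  by apply/funext => v; rewrite phi_swap.
by rewrite -(partial1E pwz) /partial1 /partial2 /= E.
Qed.

Lemma norm_reflection p z w : `|z| = 1 -> `|w| = 1 ->
  `|(reflection p).[z, w]| = `|p.[z, w]|.
Proof.
move=> z1 w1; rewrite -horner_slice slice_reflection // hornerZ.
rewrite conj_revE ?normf1_neq0 ?size_slice // (normf1_conj z1) invrK horner_slice.
by rewrite !normrM !normrX z1 w1 !expr1n !mul1r norm_conjC.
Qed.

Lemma dphi_logderiv p z w : `|z| = 1 -> `|w| = 1 -> p.[z, w] != 0 ->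
  z * dphi p z w = phi p (z, w) * angular (deg1 p) (slice w p) z.
Proof.
move=> z1 w1 pzw.
have := angular_logderiv z1 (size_slice w p) _ (slice_reflection p w1).
rewrite !deriv_slice !horner_slice => /(_ pzw) E.
rewrite /phi /quotient /= mulrAC -E /dphi.
by field.
Qed.

Lemma norm_phi p z w : `|z| = 1 -> `|w| = 1 -> p.[z, w] != 0 -> `|phi p (z, w)| = 1.
Proof.
by move=> z1 w1 pzw; rewrite /phi /quotient /= normrM normfV norm_reflection // divff ?normr_eq0.
Qed.

(** In [dphi_logderiv] both z and phi are unimodular, and the angular derivative is nonnegative. *)
Lemma angular_dphi p z w : stable_pair p -> `|z| = 1 -> `|w| = 1 -> p.[z, w] != 0 ->
  angular (deg1 p) (slice w p) z = (cmod (dphi p z w))%:C.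
Proof.
move=> sp z1 w1 pzw; rewrite -normE.
have /(congr1 Num.norm) := dphi_logderiv z1 w1 pzw.
rewrite (normrM z) z1 mul1r (normrM (phi p (z, w))) (norm_phi z1 w1 pzw) mul1r => ->.
by rewrite (ger0_norm (angular_ge0 sp z1 w1 pzw)).
Qed.

Lemma angular_compare_real p z w : stable_pair p -> `|z| = 1 -> `|w| = 1 ->
  (forall v, `|v| = 1 -> p.[z, v] != 0) ->
  cmod (dphi p z w) * cmod (phi p (z, w) - phi p (z, 0)) * cmod p.[z, 0] <=
  cmod (slope_bound p) * cmod (dphi (swapXY p) w z).
Proof.
move=> sp z1 w1 pT; have := angular_compare sp z1 w1 pT.
rewrite angular_dphi ?pT // horner_swap_slice -deg1_swap angular_dphi //; last 2 first.
- exact: stable_pair_swap.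
- by rewrite horner2_swapXY pT.
rewrite -horner_swap_slice -[slope_bound p](ger0_norm (slope_bound_ge0 p)).
by rewrite !normE -!rmorphM /= lecR cmod_real ?cmod_ge0.
Qed.

Lemma cmod_expiB1 x : cmod (expi x - 1 : C R) <= `|x|.
Proof.
rewrite -(ler_pXn2r (n := 2)) ?nnegrE ?cmod_ge0 ?normr_ge0 // cmod_sq.
rewrite reD imD reN imN /= oppr0 addr0 real_normK ?num_real //.
have := cosB1_le x; have := cos2Dsin2 x; set k := cos x; set l := sin x => E ?.
have -> : (k - 1) ^+ 2 + l ^+ 2 = (k ^+ 2 + l ^+ 2) + 1 - 2 * k by ring.
rewrite E; lra.
Qed.

(** With k the distance from exp(i x) to a, |a| <= 1 + k bounds the numerator by k^2 + 2 k. *)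
Lemma poisson_far x a r : 0 < r -> 1 < cmod a -> r <= cmod (expi x - a) ->
  re (poisson (expi x) a) <= 1 + 2 / r.
Proof.
move=> r0 a1; set k := cmod (expi x - a) => rk; have k0 : 0 < k by apply: lt_le_trans rk.
have -> : re (poisson (expi x) a) = (cmod a ^+ 2 - 1) / k ^+ 2.
  rewrite /poisson !normE (_ : (_ - 1) / _ = ((cmod a ^+ 2 - 1) / k ^+ 2)%:C) //.
  by rewrite rmorphM fmorphV rmorphB !rmorphXn.
have ak : cmod a <= 1 + k.
  rewrite -[a](subrK (expi x)) addrC; apply: le_trans (cmodD _ _) _.
  rewrite -[in X in _ + X <= _]cmodN opprB lerD2r.
  by have /norm1_cmod -> := norm_expi x.
apply: (@le_trans _ _ (1 + 2 / k)); last by rewrite lerD2l ler_pM2l // lef_pV2.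
rewrite ler_pdivrMr ?exprn_gt0 //.
have -> : (1 + 2 / k) * k ^+ 2 = k ^+ 2 + 2 * k by field; rewrite gt_eqF.
have : cmod a ^+ 2 <= (1 + k) ^+ 2 by rewrite ler_pXn2r ?nnegrE ?cmod_ge0 // addr_ge0 // ltW.
have -> : (1 + k) ^+ 2 = k ^+ 2 + 2 * k + 1 by ring.
lra.
Qed.

Lemma re_poisson_ge0 x a : 1 < cmod a -> 0 <= re (poisson (expi x) a).
Proof.
move=> a1; have : 0 <= poisson (expi x) a.
  by apply: poisson_ge0; rewrite ltW // norm_gt1.
by rewrite lecE => /andP[].
Qed.

Lemma pole_far x a r : 0 < r -> 1 < cmod a -> 2 * r <= cmod (a - 1) -> `|x| <= r ->
  re (poisson (expi x) a) <= 1 + 2 / r.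
Proof.
move=> r0 a1 far xr; apply: poisson_far => //.
have ax1 : cmod (a - 1) <= cmod (expi x - a) + cmod (expi x - 1).
  have -> : a - 1 = - (expi x - a) + (expi x - 1) by ring.
  by rewrite (le_trans (cmodD _ _)) // cmodN.
have := cmod_expiB1 x; lra.
Qed.

(** From |a - 1| < 2 r <= 1/4 follow Re a > 3/4, then |c| <= 2 r / (3/4) = 8 r / 3, and d < 2 r;
    together they stay below 8 r. *)
Lemma pole_near a r : 0 < r -> r <= 1 / 8 -> 1 < cmod a -> cmod (a - 1) < 2 * r ->
  exists c d, [/\ 0 < d, `|c| + d <= 8 * r,
    forall x, `|x| <= r ->
      re (poisson (expi x) a) <= 6 * d / (d ^+ 2 + (x - c) ^+ 2) &
    forall x, `|x - c| <= d ->
      2 / d * (1 - ((x - c) / d) ^+ 2) <= re (poisson (expi x) a)].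
Proof.
move=> r0 r8 a1 near.
have ra : 3 / 4 < re a.
  have := le_lt_trans (re_le_cmod _) near; rewrite reD reN ltr_norml => /andP[+ _].
  by move=> /= ?; lra.
have ia : `|im a| < 2 * r.
  by have := le_lt_trans (im_le_cmod _) near; rewrite imD imN /= oppr0 addr0.
have [|c [d [d0 aE cmodaE cle]]] := expi_polar a1; first by lra.
have d2 : d < 2 * r.
  have : cmod a <= cmod (a - 1) + cmod 1.
    by rewrite (le_trans _ (cmodD _ _)) // subrK.
  rewrite cmodaE; have -> : cmod (1 : C R) = 1 by apply/norm1_cmod; rewrite normr1.
  lra.
have c8 : `|c| <= 8 / 3 * r.
  apply: le_trans cle _; rewrite ler_pdivrMr; last by lra.
  apply: (@le_trans _ _ (2 * r)); first exact: ltW.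
  have : 0 <= r * (re a - 3 / 4) by rewrite mulr_ge0 ?(ltW r0) // subr_ge0 ltW.
  nra.
exists c, d; split=> //; first by lra.
- move=> x xr; apply: poisson_upper => //; first by lra.
  by have := ler_normB x c; lra.
- by move=> x xc; apply: poisson_lower.
Qed.

(** Poles at distance at least 2 r from 1 go into the constant; the others are recorded in [qs] by
    their angle and their distance to the circle. The lower bound passes from one kernel to the sum
    because all kernels are nonnegative. *)
Lemma near_poles (rs : seq (C R)) (r : R) : 0 < r -> r <= 1 / 8 ->
  {in rs, forall a, 1 < cmod a} ->
  exists qs : seq (R * R), [/\ (size qs <= size rs)%N,
    {in qs, forall q, 0 < q.2 /\ `|q.1| + q.2 <= 8 * r},
    {in `[- r, r], forall x, \sum_(a <- rs) re (poisson (expi x) a) <=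
      (1 + 2 / r) * (size rs)%:R +
      \sum_(q <- qs) 6 * q.2 / (q.2 ^+ 2 + (x - q.1) ^+ 2)} &
    {in qs, forall q, {in `[q.1 - q.2, q.1 + q.2], forall x,
      2 / q.2 * (1 - ((x - q.1) / q.2) ^+ 2) <=
      \sum_(a <- rs) re (poisson (expi x) a)}}].
Proof.
move=> r0 r8; elim: rs => [|a rs IH] rs1.
  by exists [::]; split=> // x _; rewrite !big_nil mulr0 addr0.
have a1 : 1 < cmod a := rs1 _ (mem_head _ _).
have rs1' : {in rs, forall b, 1 < cmod b}.
  by move=> b brs; rewrite rs1 // inE brs orbT.
have [qs [sqs qs8 qsu qsl]] := IH rs1'.
have sum0 x : 0 <= \sum_(b <- rs) re (poisson (expi x) b).
  by rewrite big_seq sumr_ge0 // => b /rs1'; apply: re_poisson_ge0.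
have r20 : 0 < 1 + 2 / r by rewrite ltr_wpDr // divr_ge0 // ltW.
have [near|far] := ltP (cmod (a - 1)) (2 * r); last first.
  exists qs; split=> //.
  - exact: leqW.
  - move=> x xr; rewrite big_cons.
    have ax : re (poisson (expi x) a) <= 1 + 2 / r.
      by apply: pole_far => //; move: xr; rewrite in_itv /= -ler_norml.
    apply: le_trans (lerD ax (qsu x xr)) _.
    by rewrite [size (a :: rs)]/= -[(size rs).+1%:R]natr1 mulrDr mulr1 addrA [X in X + _ <= _]addrC.
  - move=> q qqs x xq; rewrite big_cons (le_trans (qsl q qqs x xq)) // lerDr.
    exact: re_poisson_ge0.
have [c [d [d0 cd8 upp low]]] := pole_near r0 r8 a1 near.
exists ((c, d) :: qs); split.
- exact: sqs.
- by move=> q; rewrite inE => /predU1P[->|]; [|exact: qs8].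
- move=> x xr; rewrite !big_cons.
  have ax : re (poisson (expi x) a) <= 6 * d / (d ^+ 2 + (x - c) ^+ 2).
    by apply: upp; move: xr; rewrite in_itv /= -ler_norml.
  apply: le_trans (lerD ax (qsu x xr)) _.
  rewrite [size (a :: rs)]/= -[(size rs).+1%:R]natr1 mulrDr mulr1 addrCA lerD2r.
  by rewrite lerDl ltW.
- move=> q; rewrite inE => /predU1P[->|qqs] x xq; rewrite big_cons.
    apply: (@le_trans _ _ (re (poisson (expi x) a))); last by rewrite lerDl.
    by apply: low; move: xq; rewrite in_itv /= -ler_distlC distrC.
  rewrite (le_trans (qsl q qqs x xq)) // lerDr.
  exact: re_poisson_ge0.
Qed.
End InnerDerivative.

(** * ** Measurability on the torus *)

Section SliceIntegral.
Variable R : realType.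
Implicit Types (p u : {poly {poly C R}}) (P : {poly C R}) (z w : C R).
Local Notation re := (@complex.Re R).
Local Notation im := (@complex.Im R).
Local Notation "k %:C" := (real_complex R k : C R).
Local Notation mu := (@lebesgue_measure R).

(** One induction that serves both for measurability and for continuity. *)
Lemma horner2_parts (T : Type) (S : (T -> R) -> Prop) (e1 e2 : T -> C R) :
  (forall k, S (cst k)) -> (forall f g, S f -> S g -> S (f \+ g)) ->
  (forall f g, S f -> S g -> S (f \* g)) ->
  S (re \o e1) -> S (im \o e1) -> S (re \o e2) -> S (im \o e2) ->
  forall p, S (fun t => re p.[e1 t, e2 t]) /\ S (fun t => im p.[e1 t, e2 t]).
Proof.
move=> Sk SD SM re1 im1 re2 im2.
have SB (f g : T -> R) : S f -> S g -> S (f \- g).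
  move=> Sf Sg; rewrite (_ : f \- g = f \+ (cst (-1) \* g)); first by apply/SD/SM.
  by apply/funext => t /=; rewrite mulN1r.
have mul_add (f g h : T -> C R) :
    S (re \o f) -> S (im \o f) -> S (re \o g) -> S (im \o g) ->
    S (re \o h) -> S (im \o h) ->
    S (fun t => re (f t * g t + h t)) /\ S (fun t => im (f t * g t + h t)).
  move=> fr fi gr gi hr hi; split.
  - rewrite (_ : (fun t => _) = ((re \o f) \* (re \o g) \- (im \o f) \* (im \o g)) \+ (re \o h)).
      by apply: SD => //; apply: SB; apply: SM.
    by apply/funext => t; rewrite reD reM.
  - rewrite (_ : (fun t => _) = ((re \o f) \* (im \o g) \+ (im \o f) \* (re \o g)) \+ (im \o h)).
      by apply: (SD) => //; apply: SD; apply: SM.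
    by apply/funext => t; rewrite imD imM.
have one P : S (fun t => re P.[e2 t]) /\ S (fun t => im P.[e2 t]).
  elim/poly_ind: P => [|P c [IHr IHi]].
    by split; rewrite (_ : (fun t => _) = cst 0) //; apply/funext => t; rewrite horner0.
  have [] := mul_add (fun t => P.[e2 t]) e2 (cst c) IHr IHi re2 im2 (Sk _) (Sk _).
  by split; under eq_fun do rewrite hornerMXaddC.
elim/poly_ind => [|p c [IHr IHi]].
  by split; rewrite (_ : (fun t => _) = cst 0) //; apply/funext => t; rewrite !horner0.
have [cr ci] := one c.
have [] := mul_add (fun t => p.[e1 t, e2 t]) e1 (fun t => c.[e2 t]) IHr IHi re1 im1 cr ci.
have E t : (p * 'X + c%:P).[e1 t, e2 t] = p.[e1 t, e2 t] * e1 t + c.[e2 t].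
  by rewrite hornerMXaddC hornerD hornerM hornerC.
by split; under eq_fun do rewrite E.
Qed.

Definition dphi_num p : {poly {poly C R}} :=
  (reflection p)^`() * p - reflection p * p^`().

(** The inverse is written as a real power, which agrees with it at 0 too and is measurable on the
    whole line. *)
Lemma cmod_dphiE p z w :
  cmod (dphi p z w) = cmod (dphi_num p).[z, w] * (cmod p.[z, w] ^+ 2) `^ (-1).
Proof.
rewrite powR_inv1 ?sqr_ge0 // /dphi_num !hornerD !hornerN !hornerM.
rewrite /dphi; set n := _ - _; set d := p.[z, w].
apply: (@complexI R); rewrite rmorphM fmorphV rmorphXn /= -!normE.
by rewrite normrM normfV normrX.
Qed.

Local Notation mR := (measurableTypeR R).

Lemma measurable_parts p :
  measurable_fun [set: mR * mR] (fun t => re p.[expi t.1, expi t.2]) /\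
  measurable_fun [set: mR * mR] (fun t => im p.[expi t.1, expi t.2]).
Proof.
have mcos : measurable_fun [set: mR] (@cos R : mR -> mR).
  by apply: continuous_measurable_fun; exact: continuous_cos.
have msin : measurable_fun [set: mR] (@sin R : mR -> mR).
  by apply: continuous_measurable_fun; exact: continuous_sin.
apply: (@horner2_parts (mR * mR) (fun f => measurable_fun [set: mR * mR] f)
  (fun t => expi t.1) (fun t => expi t.2)).
- by move=> k; exact: measurable_cst.
- by move=> f g; exact: measurable_funD.
- by move=> f g; exact: measurable_funM.
- exact: (measurableT_comp mcos measurable_fst).
- exact: (measurableT_comp msin measurable_fst).
- exact: (measurableT_comp mcos measurable_snd).
- exact: (measurableT_comp msin measurable_snd).
Qed.

Lemma measurable_cmod p :
  measurable_fun [set: mR * mR] (fun t => cmod p.[expi t.1, expi t.2]).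
Proof.
under eq_fun do rewrite cmodE.
have [pr pi] := measurable_parts p.
have msqrt : measurable_fun [set: mR] (Num.sqrt : mR -> mR).
  by apply: continuous_measurable_fun; exact: sqrt_continuous.
apply: (measurableT_comp msqrt).
by apply: measurable_funD; apply: measurable_funX.
Qed.

Lemma measurable_dphi p :
  measurable_fun [set: mR * mR] (fun t => cmod (dphi p (expi t.1) (expi t.2))).
Proof.
under eq_fun do rewrite cmod_dphiE.
apply: measurable_funM; first exact: measurable_cmod.
apply: (measurableT_comp (@measurable_powR R (-1))).
by apply: measurable_funX; exact: measurable_cmod.
Qed.

Lemma cmod_horner_expi_continuous P c :
  continuous (fun x : R => cmod (P.[expi x] - c)).
Proof.
have d x : is_cderive (fun t => P.[expi t] - c) (ii R * expi x * P^`().[expi x] + 0) x.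
  exact: is_cderiveD (is_cderive_horner P x) (is_cderive_cst (- c) x).
have [cr ci] := is_cderive_continuous d.
exact: cmod_continuous.
Qed.
End SliceIntegral.

(** * ** The slice inequality for the partial derivatives *)

Section SliceIntegralBound.
Variable R : realType.
Implicit Types (p u : {poly {poly C R}}) (P Q : {poly C R}) (z w : C R).
Local Notation re := (@complex.Re R).
Local Notation im := (@complex.Im R).
Local Notation "k %:C" := (real_complex R k : C R).
Local Notation mu := (@lebesgue_measure R).

Lemma is_cderive_quotient P Q x : P.[expi x] != 0 ->
  is_cderive (fun t => Q.[expi t] / P.[expi t])
    (ii R * (expi x * ((Q^`().[expi x] * P.[expi x] - Q.[expi x] * P^`().[expi x])
       / P.[expi x] ^+ 2))) x.
Proof.
move=> P0; apply: is_cderive_eq (is_cderiveM (is_cderive_horner Q x)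
  (is_cderiveV P0 (is_cderive_horner P x))) _.
by field.
Qed.

Lemma cmod_quotient_continuous P Q c : (forall x, P.[expi x] != 0) ->
  continuous (fun x : R => cmod (Q.[expi x] / P.[expi x] - c)).
Proof.
move=> P0; have [cr ci] := is_cderive_continuous (fun x =>
  is_cderiveD (is_cderive_quotient Q (P0 x)) (is_cderive_cst (- c) x)).
exact: cmod_continuous.
Qed.

Lemma angular_expi_continuous P m : (forall x : R, P.[expi x] != 0) ->
  continuous (fun x : R => re (angular m P (expi x))).
Proof.
move=> P0.
have [cr _] := is_cderive_continuous
  (fun x => is_cderive_quotient ('X * P^`()) (P0 x)).
rewrite (_ : (fun x => _) =
    (fun x => re m%:R - 2 * re (('X * P^`()).[expi x] / P.[expi x]))).
  move=> x; apply: cvgB; first exact: cvg_cst.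
  by apply: cvgM; [exact: cvg_cst|exact: cr].
apply/funext => x; rewrite /angular reD reN reD reJ hornerM hornerX; ring.
Qed.

Lemma re_sum (I : Type) (r : seq I) (F : I -> C R) :
  re (\sum_(i <- r) F i) = \sum_(i <- r) re (F i).
Proof. by elim: r => [|i r IH]; rewrite ?big_nil // !big_cons reD IH. Qed.

Lemma dphi_poisson p w : stable_pair p -> `|w| = 1 ->
  (forall v, `|v| = 1 -> p.[v, w] != 0) ->
  exists rs : seq (C R), [/\ (size rs <= deg1 p)%N, {in rs, forall a, 1 < cmod a} &
    forall x, cmod (dphi p (expi x) w) =
      (deg1 p - size rs)%:R + \sum_(a <- rs) re (poisson (expi x) a)].
Proof.
move=> sp w1 pT; have [rs [c0 E srs _ /(_ pT) rs1]] := slice_roots sp w1.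
exists rs; split=> //.
  by move=> a /rs1; rewrite norm_gt1.
move=> x; have x1 := norm_expi x; have px := pT _ x1.
have thE := angular_dphi sp x1 w1 px.
have sum_poisson : angular (deg1 p) (slice w p) (expi x) =
    (deg1 p - size rs)%:R + \sum_(a <- rs) poisson (expi x) a.
  by apply: (angularE c0 E srs x1); rewrite horner_slice.
have -> : cmod (dphi p (expi x) w) = re (angular (deg1 p) (slice w p) (expi x)).
  by rewrite thE.
by rewrite sum_poisson reD re_sum re_nat.
Qed.

Lemma dphi_expi_continuous p w : stable_pair p -> `|w| = 1 ->
  (forall v, `|v| = 1 -> p.[v, w] != 0) ->
  continuous (fun x => cmod (dphi p (expi x) w)).
Proof.
move=> sp w1 pT.
have E : (fun x => cmod (dphi p (expi x) w)) =
    (fun x => re (angular (deg1 p) (slice w p) (expi x))).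
  by apply/funext => x; rewrite angular_dphi // ?norm_expi // pT // norm_expi.
rewrite E; apply: angular_expi_continuous => x.
by rewrite horner_slice pT // norm_expi.
Qed.

(** By [dphi_logderiv], f(x) = phi p (exp(i x), w) satisfies f' = i |dphi| f: it turns
    counterclockwise with speed |dphi|. *)
Lemma phi_expi_derive p w (x : R) : `|w| = 1 -> stable_pair p ->
  (forall v, `|v| = 1 -> p.[v, w] != 0) ->
  is_derive x 1 (fun t => re (phi p (expi t, w)))
    (- (cmod (dphi p (expi x) w) * im (phi p (expi x, w)))) /\
  is_derive x 1 (fun t => im (phi p (expi t, w)))
    (cmod (dphi p (expi x) w) * re (phi p (expi x, w))).
Proof.
move=> w1 sp pT; have x1 := norm_expi x; have px := pT _ x1.
have P0 : (slice w p).[expi x] != 0 by rewrite horner_slice.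
have := is_cderive_quotient (slice w (reflection p)) P0.
rewrite !deriv_slice !horner_slice -/(dphi p (expi x) w).
rewrite (dphi_logderiv x1 w1 px) (angular_dphi sp x1 w1 px).
have E : (fun t : R => (slice w (reflection p)).[expi t] / (slice w p).[expi t]) =
    (fun t : R => phi p (expi t, w)).
  by apply/funext => t; rewrite !horner_slice.
rewrite E; set T := cmod _; set f := phi p (expi x, w); case.
have -> : re (ii R * (f * T%:C)) = - (T * im f).
  by rewrite reM imM reM /= ; ring.
have -> : im (ii R * (f * T%:C)) = T * re f.
  by rewrite imM reM imM /= ; ring.
by [].
Qed.

(** For |z| = 1, p(z, 0) is nonzero because 0 lies in the open disk, so phi(., 0) is continuous on
    the circle. *)
Lemma phi0_near p (e : R) : stable_pair p -> 0 < e ->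
  exists2 r : R, 0 < r & forall x, `|x| < r ->
    cmod (phi p (expi x, 0) - phi p (1, 0)) < e /\
    cmod p.[1, 0] / 2 < cmod p.[expi x, 0].
Proof.
move=> sp e0.
have sp' := stable_pair_swap sp.
have p0 x : p.[expi x, 0] != 0.
  by rewrite -horner2_swapXY slice_disk_neq0 ?norm_expi // normr0.
have P0 (x : R) : (slice 0 p).[expi x] != 0 by rewrite horner_slice.
have g0 : 0 < cmod p.[1, 0] by rewrite cmod_gt0 -expi0.
have phiE (x : R) : phi p (expi x, 0) = (slice 0 (reflection p)).[expi x] / (slice 0 p).[expi x].
  by rewrite !horner_slice.
have c1 := @cmod_quotient_continuous _ (slice 0 (reflection p)) (phi p (1, 0)) P0.
have c2 := @cmod_horner_expi_continuous R (slice 0 p) 0.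
have near1 : \forall x \near (0 : R),
    cmod ((slice 0 (reflection p)).[expi x] / (slice 0 p).[expi x] - phi p (1, 0)) < e.
  have := c1 0; rewrite /continuous_at -phiE expi0 subrr.
  have -> : cmod (0 : C R) = 0 by apply/eqP; rewrite cmod_eq0.
  by move=> /cvgr_lt; apply.
have near2 : \forall x \near (0 : R),
    cmod p.[1, 0] / 2 < cmod ((slice 0 p).[expi x] - 0).
  have := c2 0; rewrite /continuous_at subr0 horner_slice expi0 => /cvgr_gt; apply.
  by rewrite ltr_pdivrMr // ltr_pMr // ltr1n.
have [r /= r0 H] := (nbhs_ballP _ _).1 (filterI near1 near2).
exists r; first exact: r0.
move=> x xr; have [] := H x.
  by rewrite -ball_normE /= sub0r normrN.
by rewrite -phiE subr0 horner_slice.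
Qed.

(** The constants are fixed before y, so the inequality can be integrated in y. The zero-free slice
    at y is for the Poisson formula, those at x other than 0 for the comparison of the two
    derivatives. *)
Lemma slice_integral_bound p : stable_pair p ->
  exists2 a0 : R, 0 < a0 & forall a s, 0 < a -> a <= a0 -> 1 <= s ->
  exists C1 C2 : R, [/\ 0 <= C1, 0 <= C2 & forall y,
    (forall v, `|v| = 1 -> p.[v, expi y] != 0) ->
    (forall x, x != 0 -> `|x| <= 8 * a -> forall v, `|v| = 1 -> p.[expi x, v] != 0) ->
    (\int[mu]_(x in `[(- a)%R, a]) (cmod (dphi p (expi x) (expi y)) `^ s)%:E <=
     C1%:E + C2%:E * \int[mu]_(x in `[(- (8 * a))%R, (8 * a)%R])
       (cmod (dphi (swapXY p) (expi y) (expi x)) `^ s)%:E)%E].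
Proof.
move=> sp; pose lam := phi p (1, 0); pose K1 := 1 + cmod lam.
have K1_ge1 : 1 <= K1 by rewrite lerDl cmod_ge0.
have K1_gt0 : 0 < K1 by apply: lt_le_trans K1_ge1.
(* For f = phi(z, w) and f0 = phi(z, 0), |f - lam| <= K1 and |f0 - lam| < 1 / (16 K1) give |f -
   lam|^2 - 1/16 <= K1 |f - f0|. *)
have e0 : 0 < (16 * K1)^-1 by rewrite invr_gt0 mulr_gt0.
have [r r0 near0] := phi0_near sp e0.
(* The first bound is the one of [near_poles]; the second gives 8 a < r, so that [near0] covers the
   long interval. *)
exists (Num.min (1 / 8) (r / 16)); first by rewrite lt_min !divr_gt0.
move=> a s a0; rewrite le_min => /andP[a8 ar] s1.
pose g := cmod p.[1, 0]; pose K := cmod (slope_bound p).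
have g0 : 0 < g.
  rewrite cmod_gt0 -horner2_swapXY slice_disk_neq0 ?normr0 ?normr1 //.
  exact: stable_pair_swap.
(* The summand 1 keeps [B] positive even if [K] is 0. *)
pose B := K1 * (2 * K / g) + 1; pose m := deg1 p.
have KB : 0 <= K1 * (2 * K / g).
  by rewrite mulr_ge0 ?(ltW K1_gt0) // divr_ge0 ?(ltW g0) // mulr_ge0 // cmod_ge0.
have B0 : 0 < B by rewrite ltr_pwDr.
pose A := m%:R + (1 + 2 / a) * m%:R.
have A0 : 0 <= A.
  by rewrite addr_ge0 // mulr_ge0 // addr_ge0 // divr_ge0 // ltW.
exists (bound1 s a A m), (bound2 s B m); split.
- by rewrite !mulr_ge0 ?exprn_ge0 ?powR_ge0 ?(ltW a0).
- by rewrite !mulr_ge0 ?exprn_ge0 ?powR_ge0 ?pi_ge0 ?(ltW B0).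
move=> y pTy pTx; have y1 := norm_expi y.
have [rs [srs rs1 thE]] := dphi_poisson sp y1 pTy.
have [qs [sqs qs8 qsu qsl]] := near_poles a0 a8 rs1.
pose u x := re (phi p (expi x, expi y)); pose v x := im (phi p (expi x, expi y)).
have uv x : u x ^+ 2 + v x ^+ 2 = 1.
  rewrite -cmod_sq (_ : cmod _ = 1) ?expr1n //; apply/norm1_cmod.
  by rewrite norm_phi ?norm_expi // pTy // norm_expi.
apply: (@slice_bound _ s a A B m (fun x => cmod (dphi p (expi x) (expi y))) u v
  (fun x => cmod (dphi (swapXY p) (expi y) (expi x))) (re lam) (im lam) qs) => //.
- exact: leq_trans srs.
- exact: dphi_expi_continuous.
- by move=> x; exact: cmod_ge0.
- by move=> x; case: (phi_expi_derive x y1 sp pTy).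
- by move=> x; case: (phi_expi_derive x y1 sp pTy).
- apply: measurable_funTS.
  exact: (measurableT_comp (measurable_dphi (swapXY p)) (pair1_measurable y)).
- by move=> x _; exact: cmod_ge0.
- move=> x xa; rewrite thE /A -addrA lerD ?ler_nat ?leq_subr //.
  apply: le_trans (qsu x xa) _; rewrite lerD2r ler_wpM2l ?ler_nat //.
  by rewrite addr_ge0 // divr_ge0 // ltW.
- by move=> q qqs x xq; rewrite thE (le_trans (qsl q qqs x xq)) // lerDr.
move=> x; rewrite in_itv /= -ler_norml => xa x0.
have xr : `|x| < r by lra.
have [d1 d2] := near0 x xr; have x1 := norm_expi x.
have := angular_compare_real sp x1 y1 (pTx x x0 xa).
rewrite -/K; set psi := cmod (dphi (swapXY p) _ _); set th := cmod (dphi p _ _).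
set f := phi p (expi x, expi y); set f0 := phi p (expi x, 0).
set N := cmod (f - f0) => key.
have th0 : 0 <= th := cmod_ge0 _; have N0 : 0 <= N := cmod_ge0 _.
have psi0 : 0 <= psi := cmod_ge0 _.
have f1 : cmod f = 1.
  by apply/norm1_cmod; rewrite norm_phi // pTy.
have WE : 15 / 16 + re lam ^+ 2 + im lam ^+ 2 - 2 * (re lam * u x + im lam * v x) =
    cmod (f - lam) ^+ 2 - 1 / 16.
  rewrite cmod_sq reD imD reN imN -/(u x) -/(v x).
  have := uv x; set u' := u x; set v' := v x => E.
  have -> : (u' - re lam) ^+ 2 + (v' - im lam) ^+ 2 = (u' ^+ 2 + v' ^+ 2)
    + re lam ^+ 2 + im lam ^+ 2 - 2 * (re lam * u' + im lam * v') by ring.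
  by rewrite E; field.
have fl1 : cmod (f - lam) <= K1 by rewrite (le_trans (cmodD _ _)) // cmodN f1.
have fl2 : cmod (f - lam) <= N + (16 * K1)^-1.
  have -> : f - lam = (f - f0) + (f0 - lam) by ring.
  by rewrite (le_trans (cmodD _ _)) // lerD2l ltW.
have WN : cmod (f - lam) ^+ 2 - 1 / 16 <= K1 * N.
  have : cmod (f - lam) ^+ 2 <= K1 * (N + (16 * K1)^-1).
    by rewrite expr2 ler_pM ?cmod_ge0.
  have -> : K1 * (N + (16 * K1)^-1) = K1 * N + 1 / 16 by field; rewrite gt_eqF.
  by rewrite lerBlDr.
rewrite WE; apply: (@le_trans _ _ (K1 * (th * N))).
  by rewrite mulrCA ler_wpM2l.
have thN : th * N <= 2 * K / g * psi.
  have : th * N * (g / 2) <= K * psi.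
    by apply: le_trans key; rewrite ler_wpM2l ?mulr_ge0 // ltW.
  have -> : 2 * K / g * psi = K * psi / (g / 2) by field; rewrite gt_eqF.
  by rewrite ler_pdivlMr // divr_gt0.
apply: (@le_trans _ _ (K1 * (2 * K / g) * psi)).
  by rewrite -mulrA ler_wpM2l // ltW.
by rewrite ler_wpM2r // lerDl.
Qed.
End SliceIntegralBound.

(** * Integrals over the torus *)

Section PlaneIntegrals.
Variable R : realType.
Local Notation mu := (@lebesgue_measure R).
Local Notation mR := (measurableTypeR R).
Local Notation mu2 := (angle_measure R).
Implicit Types (h : mR * mR -> R).

(* The set of angles lying over an open subset of the torus is not known here
   to be measurable. Monotonicity holds all the same, since the integral of a
   nonnegative function is a supremum over the simple functions below it. *)
Lemma ge0_le_integral_patch d (T : measurableType d) (m : {measure set T -> \bar R})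
    (D1 D2 : set T) (f1 f2 : T -> \bar R) :
  (forall x, D1 x -> 0 <= f1 x)%E -> (forall x, D2 x -> 0 <= f2 x)%E ->
  (forall x, (f1 \_ D1) x <= (f2 \_ D2) x)%E ->
  (\int[m]_(x in D1) f1 x <= \int[m]_(x in D2) f2 x)%E.
Proof.
move=> f10 f20 f12; rewrite !ge0_integralE //; apply: ereal_sup_le.
by move=> _ [g gf <-]; exists g => // x; apply: le_trans (gf x) (f12 x).
Qed.

Lemma integral_rect_y (A B : set mR) h : measurable A -> measurable B ->
  measurable_fun setT h -> (forall t, 0 <= h t) ->
  (\int[mu2]_(t in A `*` B) (h t)%:E = \int[mu]_(y in B) \int[mu]_(x in A) (h (x, y))%:E)%E.
Proof.
move=> mA mB mh h0; rewrite integral_mkcond /angle_measure fubini_tonelli2 /=.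
- rewrite [RHS]integral_mkcond; apply: eq_integral => y _.
  rewrite /fubini_G patchE; case: ifPn => [/set_mem yB|yB].
    rewrite [RHS]integral_mkcond; apply: eq_integral => x _.
    rewrite !patchE; congr (if _ then _ else _).
    by apply/idP/idP; rewrite !inE /=; [case|].
  rewrite integral0_eq // => x _; rewrite patchE ifF //.
  by apply: contraNF yB; rewrite !inE => -[].
- apply/(measurable_restrictT _ _).1; first exact: measurableX.
  by apply/measurable_EFinP; apply: measurable_funTS.
- by move=> t; rewrite patchE; case: ifP; rewrite ?lee_fin.
Qed.

Lemma integral_rect_x (A B : set mR) h : measurable A -> measurable B ->
  measurable_fun setT h -> (forall t, 0 <= h t) ->
  (\int[mu2]_(t in A `*` B) (h t)%:E = \int[mu]_(x in A) \int[mu]_(y in B) (h (x, y))%:E)%E.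
Proof.
move=> mA mB mh h0; rewrite integral_mkcond /angle_measure fubini_tonelli1 /=.
- rewrite [RHS]integral_mkcond; apply: eq_integral => x _.
  rewrite /fubini_F patchE; case: ifPn => [/set_mem xA|xA].
    rewrite [RHS]integral_mkcond; apply: eq_integral => y _.
    rewrite !patchE; congr (if _ then _ else _).
    by apply/idP/idP; rewrite !inE /=; [case|].
  rewrite integral0_eq // => y _; rewrite patchE ifF //.
  by apply: contraNF xA; rewrite !inE => -[].
- apply/(measurable_restrictT _ _).1; first exact: measurableX.
  by apply/measurable_EFinP; apply: measurable_funTS.
- by move=> t; rewrite patchE; case: ifP; rewrite ?lee_fin.
Qed.

Lemma integral_square_swap (A : set mR) h : measurable A ->
  measurable_fun setT h -> (forall t, 0 <= h t) ->
  (\int[mu2]_(t in A `*` A) (h (t.2, t.1))%:E = \int[mu2]_(t in A `*` A) (h t)%:E)%E.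
Proof.
move=> mA mh h0; rewrite (@integral_rect_y _ _ (fun t => h (t.2, t.1))) //.
  by rewrite integral_rect_x.
exact: (measurableT_comp mh (measurable_fun_pair measurable_snd measurable_fst)).
Qed.

(** The slice inequality is integrated over |y| <= a: the line y = 0 is null, the constant has a
    finite integral, and the strip where [h2] is integrated lies in the square of half-side b. *)
Lemma rect_integral_lty (a b : R) h1 h2 (C1 C2 : R) : 0 < a -> a <= b -> 0 <= C1 -> 0 <= C2 ->
  measurable_fun setT h1 -> measurable_fun setT h2 ->
  (forall t, 0 <= h1 t) -> (forall t, 0 <= h2 t) ->
  (forall y : R, y != 0 -> `|y| <= a ->
    (\int[mu]_(x in `[(- a)%R, a]) (h1 (x, y))%:E <=
    C1%:E + C2%:E * \int[mu]_(x in `[(- b)%R, b]) (h2 (x, y))%:E)%E) ->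
  (\int[mu2]_(t in `[(- b)%R, b] `*` `[(- b)%R, b]) (h2 t)%:E < +oo)%E ->
  (\int[mu2]_(t in `[(- a)%R, a] `*` `[(- a)%R, a]) (h1 t)%:E < +oo)%E.
Proof.
move=> a0 ab C10 C20 mh1 mh2 h10 h20 h12 fin2.
have fin2' : (\int[mu2]_(t in `[(- b)%R, b] `*` `[(- a)%R, a]) (h2 t)%:E < +oo)%E.
  apply: le_lt_trans fin2; apply: ge0_subset_integral.
  - exact: measurableX.
  - exact: measurableX.
  - by apply/measurable_EFinP; apply: measurable_funTS.
  - by move=> t _; rewrite lee_fin.
  - move=> [x y] [] /= xb; rewrite !in_itv /= => /andP[y1 y2]; split=> //=.
    by apply/andP; split; lra.
rewrite integral_rect_y in fin2' => //; rewrite integral_rect_y //.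
have mint c h : measurable_fun setT h -> (forall t, 0 <= h t) ->
    measurable_fun `[- a, a] (fun y => \int[mu]_(x in `[(- c)%R, c]) (h (x, y))%:E)%E.
  move=> mh h0.
  pose k : mR * mR -> \bar R := (EFin \o h) \_ (`[(- c)%R, c] `*` setT).
  have mk : measurable_fun setT k.
    apply/(measurable_restrictT _ _).1; first exact: measurableX.
    by apply/measurable_EFinP; apply: measurable_funTS.
  have k0 t : (0 <= k t)%E by rewrite /k patchE; case: ifP; rewrite /= ?lee_fin.
  apply: measurable_funTS.
  have := @measurable_fun_fubini_tonelli_G _ _ _ _ R mu k mk k0; congr measurable_fun.
  apply/funext => y; rewrite /fubini_G [RHS]integral_mkcond; apply: eq_integral => x _.
  rewrite /k !patchE; congr (if _ then _ else _).
  by apply/idP/idP; rewrite !inE /=; [case|].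
have int0 c h y : (forall t, 0 <= h t) ->
    (0 <= \int[mu]_(x in `[(- c)%R, c]) (h (x, y))%:E)%E.
  by move=> h0; apply: integral_ge0 => x _; rewrite lee_fin.
apply: (@le_lt_trans _ _ (\int[mu]_(y in `[(- a)%R, a])
   (C1%:E + C2%:E * \int[mu]_(x in `[(- b)%R, b]) (h2 (x, y))%:E))%E).
  apply: ae_ge0_le_integral => //.
  - by move=> y _; exact: int0.
  - exact: mint.
  - by move=> y _; rewrite adde_ge0 ?mule_ge0 ?lee_fin ?int0.
  - apply: emeasurable_funD => //; apply: emeasurable_funM => //; exact: mint.
  exists [set 0]; split=> //; first exact: lebesgue_measure_set1.
  move=> y /= ny; apply: contrapT => y0; apply: ny => ya.
  apply: h12; first exact/eqP.
  by move: ya; rewrite /= in_itv /= ler_norml.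
rewrite ge0_integralD //; last 2 first.
- by move=> y _; rewrite mule_ge0 ?lee_fin ?int0.
- apply: emeasurable_funM => //; exact: mint.
rewrite ge0_integralZl //; last 2 first.
- exact: mint.
- by move=> y _; exact: int0.
apply: lte_add_pinfty.
  have -> : (\int[mu]_(y in `[(- a)%R, a]) C1%:E = C1%:E * mu `[(- a)%R, a]%classic)%E.
    exact: integral_cst.
  rewrite lebesgue_measure_itv /= lte_fin.
  by case: ifP => _; rewrite ?mule0 ?ltry // -EFinB -EFinM ltry.
by rewrite lte_mul_pinfty // lee_fin.
Qed.
End PlaneIntegrals.

(** * ** Transfer of integrability between small squares *)

Section LocalIntegrability.
Variable R : realType.
Implicit Types (p u : {poly {poly C R}}) (P c : {poly C R}) (z w : C R).
Local Notation re := (@complex.Re R).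
Local Notation im := (@complex.Im R).
Local Notation "k %:C" := (real_complex R k : C R).
Local Notation mR := (measurableTypeR R).
Local Notation mu2 := (angle_measure R).

Lemma isolated_roots c : c != 0 -> exists2 r : R, 0 < r &
  forall w, w != 1 -> cmod (w - 1) <= r -> c.[w] != 0.
Proof.
move=> c0; have [rs E] := closed_field_poly_normal c.
have lc0 : lead_coef c != 0 by rewrite lead_coef_eq0.
have [r r0 H] : exists2 r : R, 0 < r & {in rs, forall a, a != 1 -> r < cmod (a - 1)}.
  elim: rs {E} => [|a rs [r r0 H]]; first by exists 1.
  have [a1|a1] := eqVneq a 1.
    exists r => // b; rewrite inE => /predU1P[->|]; last exact: H.
    by rewrite a1 eqxx.
  have d0 : 0 < cmod (a - 1) by rewrite cmod_gt0 subr_eq0.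
  exists (Num.min r (cmod (a - 1) / 2)); first by rewrite lt_min r0 divr_gt0.
  move=> b; rewrite inE => /predU1P[->|brs] b1; rewrite gt_min.
    by rewrite [X in _ || X](_ : _ = true) ?orbT // ltr_pdivrMr // ltr_pMr // ltr1n.
  by rewrite H.
exists r => // w w1 wr; rewrite E hornerZ mulf_neq0 //.
suff : ~~ root (\prod_(a <- rs) ('X - a%:P)) w by [].
rewrite root_prod_XsubC; apply/negP => /H /(_ w1).
by rewrite ltNge wr.
Qed.

(** The second coordinates of the torus zeros are roots of one nonzero polynomial, so 1 is isolated
    among them. *)
Lemma torus_zeros_near p : stable_pair p -> exists2 r : R, 0 < r &
  forall w, `|w| = 1 -> w != 1 -> cmod (w - 1) <= r ->
    forall v, `|v| = 1 -> p.[v, w] != 0.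
Proof.
move=> /torus_zeros[c c0 pc]; have [r r0 H] := isolated_roots c0.
by exists r => // w w1 wN1 wr v v1; apply: pc => //; apply: H.
Qed.

Lemma expi_eq1 (x : R) : `|x| <= pi -> expi x = 1 :> C R -> x = 0.
Proof.
move=> xpi /(congr1 re) /= cx; apply/eqP; rewrite -normr_eq0.
have cnx : cos `|x| = 1.
  by have [x0|x0] := ger0P x; rewrite ?cosN.
have <- : acos (cos `|x|) = `|x| by rewrite cosK // in_itv /= normr_ge0 xpi.
by rewrite cnx acos1.
Qed.

Lemma torus_cmod_continuous u : continuous (fun t : R * R => cmod u.[expi t.1, expi t.2]).
Proof.
have [cr ci] : continuous (fun t : R * R => re u.[expi t.1, expi t.2]) /\
               continuous (fun t : R * R => im u.[expi t.1, expi t.2]).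
  apply: (@horner2_parts R (R * R) (fun f : R * R -> R => continuous f)
    (fun t => expi t.1) (fun t => expi t.2)).
  - by move=> k; exact: cst_continuous.
  - by move=> f g cf cg t; apply: cvgD; [exact: cf|exact: cg].
  - by move=> f g cf cg t; apply: cvgM; [exact: cf|exact: cg].
  - by move=> t; apply: (@continuous_comp _ _ _ fst (@cos R)); [exact: cvg_fst|exact: continuous_cos].
  - by move=> t; apply: (@continuous_comp _ _ _ fst (@sin R)); [exact: cvg_fst|exact: continuous_sin].
  - by move=> t; apply: (@continuous_comp _ _ _ snd (@cos R)); [exact: cvg_snd|exact: continuous_cos].
  - by move=> t; apply: (@continuous_comp _ _ _ snd (@sin R)); [exact: cvg_snd|exact: continuous_sin].
exact: cmod_continuous.
Qed.

Lemma dphi_bounded p (K : set (R * R)) : compact K ->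
  (forall t, K t -> p.[expi t.1, expi t.2] != 0) ->
  exists2 M : R, 0 <= M & forall t, K t -> cmod (dphi p (expi t.1) (expi t.2)) <= M.
Proof.
move=> cK pK; have [->|/set0P K0] := eqVneq K set0; first by exists 0.
have [t0 /set_mem Kt0 tmin] := compact_EVT_min K0 cK
  (continuous_subspaceT (torus_cmod_continuous (u := p))).
have [t1 _ tmax] := compact_EVT_max K0 cK
  (continuous_subspaceT (torus_cmod_continuous (u := dphi_num p))).
exists (cmod (dphi_num p).[expi t1.1, expi t1.2] *
        (cmod p.[expi t0.1, expi t0.2] ^+ 2)^-1).
  by rewrite mulr_ge0 ?invr_ge0 ?sqr_ge0 ?cmod_ge0.
move=> t Kt; rewrite cmod_dphiE powR_inv1 ?sqr_ge0 //.
have m0 : 0 < cmod p.[expi t0.1, expi t0.2] by rewrite cmod_gt0 pK.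
have mt := tmin t (mem_set Kt); have mt0 := lt_le_trans m0 mt.
rewrite ler_pM ?cmod_ge0 ?invr_ge0 ?sqr_ge0 ?tmax ?inE //.
rewrite lef_pV2 ?posrE ?exprn_gt0 // ler_pXn2r ?nnegrE ?cmod_ge0 //.
Qed.

Definition square (a : R) : set (mR * mR) := `[(- a), a] `*` `[(- a), a].

Lemma squareP a (t : mR * mR) : square a t <-> `|t.1| <= a /\ `|t.2| <= a.
Proof. by rewrite /square /= !in_itv /= -!ler_norml. Qed.

Lemma measurable_square a : measurable (square a).
Proof. exact: measurableX. Qed.

(** Built on [dphi] rather than [partial1], so that it is measurable on the whole plane. *)
Definition power p (s : R) (t : mR * mR) : R := cmod (dphi p (expi t.1) (expi t.2)) `^ s.

Lemma measurable_power p s : measurable_fun setT (power p s).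
Proof. exact: (measurableT_comp (@measurable_powR R s) (measurable_dphi p)). Qed.

Lemma power_ge0 p s t : 0 <= power p s t.
Proof. exact: powR_ge0. Qed.

(** Nonzero angles of modulus at most 8 a <= 1 < pi give points other than 1 to which
    [torus_zeros_near] applies, for [p] and for its swap; this supplies both conditions of the slice
    inequality. *)
Lemma square_integral_transfer p : stable_pair p -> exists2 a0 : R, 0 < a0 &
  forall a s, 0 < a -> a <= a0 -> 1 <= s ->
  (\int[mu2]_(t in square (8 * a)) (power (swapXY p) s (t.2, t.1))%:E < +oo)%E ->
  (\int[mu2]_(t in square a) (power p s t)%:E < +oo)%E.
Proof.
move=> sp; have [a1 a10 H] := slice_integral_bound sp.
have [r r0 Hr] := torus_zeros_near sp.
have [r' r'0 Hr'] := torus_zeros_near (stable_pair_swap sp).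
have m0 : 0 < Num.min (Num.min a1 (1 / 8)) (Num.min (r / 8) (r' / 8)).
  by rewrite !lt_min a10 !divr_gt0.
exists (Num.min (Num.min a1 (1 / 8)) (Num.min (r / 8) (r' / 8))); first exact: m0.
move=> a s a0.
rewrite !le_min => /andP[/andP[aa1 a8] /andP[ar ar']] s1.
have [C1 [C2 [C10 C20 HC]]] := H a s a0 aa1 s1.
have small (x : R) : x != 0 -> `|x| <= 8 * a ->
    expi x != 1 :> C R /\ cmod (expi x - 1 : C R) <= 8 * a.
  move=> x0 xa; split; last exact: le_trans (cmod_expiB1 x) xa.
  apply: contraNneq x0 => /expi_eq1 -> //.
  by apply: le_trans xa _; have := pi_ge2 R; lra.
apply: (@rect_integral_lty R a (8 * a) (power p s)
  (fun t => power (swapXY p) s (t.2, t.1)) C1 C2) => //.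
- by lra.
- exact: measurable_power.
- exact: (measurableT_comp (measurable_power (swapXY p) s)
    (measurable_fun_pair measurable_snd measurable_fst)).
- by move=> t; exact: power_ge0.
- by move=> t; exact: power_ge0.
move=> y y0 ya; apply: HC.
- have [|y1 yr] := small y y0; first by lra.
  apply: (Hr _ (norm_expi y) y1); lra.
- move=> x x0 xa v v1; have [x1 xr] := small x x0 xa.
  rewrite -horner2_swapXY; apply: (Hr' _ (norm_expi x) x1) => //; lra.
Qed.
End LocalIntegrability.

(** * ** From small squares to neighbourhoods of (1, 1) *)

Section Localization.
Variable R : realType.
Implicit Types (p : {poly {poly C R}}) (z w : C R).
Local Notation "k %:C" := (real_complex R k : C R).
Local Notation mR := (measurableTypeR R).
Local Notation mu2 := (angle_measure R).

Lemma measurable_angles : measurable (angles R : set (mR * mR)).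
Proof. exact: measurableX. Qed.

Lemma angles_lty : (mu2 (angles R) < +oo)%E.
Proof.
have -> : (mu2 (angles R) = @lebesgue_measure R `](- pi)%R, pi]%classic *
    @lebesgue_measure R `](- pi)%R, pi]%classic)%E.
  exact: product_measure1E.
rewrite lebesgue_measure_itv /= lte_fin.
have pi0 := pi_gt0 R; have -> : - pi < pi :> R by lra.
by rewrite -EFinB -EFinM ltry.
Qed.

(** [f1] and [f2] stand for the actual derivatives, [h1] and [h2] for their closed forms. Finiteness
    passes from [D] to the square of half-side b, by hypothesis to that of half-side a, and back to
    [D], since [h1] is bounded on the rest of it. *)
Lemma square_integral_lty (D : set (mR * mR)) (f1 f2 h1 h2 : mR * mR -> R) (a b M : R) :
  square b `<=` D -> D `<=` angles R -> square a `<=` angles R ->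
  measurable_fun setT h1 ->
  (forall t, 0 <= f1 t) -> (forall t, 0 <= f2 t) ->
  (forall t, 0 <= h1 t) -> (forall t, 0 <= h2 t) ->
  (forall t, D t -> t <> (0, 0) -> f1 t = h1 t) ->
  (forall t, D t -> h2 t <= f2 t) ->
  (forall t, D t -> ~ square a t -> h1 t <= M) ->
  ((\int[mu2]_(t in square b) (h2 t)%:E < +oo)%E ->
   (\int[mu2]_(t in square a) (h1 t)%:E < +oo)%E) ->
  (\int[mu2]_(t in D) (f2 t)%:E < +oo)%E ->
  (\int[mu2]_(t in D) (f1 t)%:E < +oo)%E.
Proof.
move=> bD Dang aang mh1 f10 f20 h10 h20 fh1 hf2 hM h21 fin2.
have {h21} fin1 : (\int[mu2]_(t in square a) (h1 t)%:E < +oo)%E.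
  apply: h21; apply: le_lt_trans fin2; apply: ge0_le_integral_patch.
  - by move=> t _; rewrite lee_fin.
  - by move=> t _; rewrite lee_fin.
  move=> t; rewrite !patchE; case: ifPn => [/set_mem bt|_].
    by rewrite ifT ?inE ?lee_fin; [exact/hf2/bD|exact: bD].
  by case: ifP => // _; rewrite lee_fin.
(* The term [f1 (0, 0)] covers the one point where [f1] and [h1] may differ, so that the comparison
   holds at every point, as [ge0_le_integral_patch] asks. *)
pose k := `|M| + f1 (0, 0).
have k0 : 0 <= k by rewrite addr_ge0.
pose g t := (((EFin \o h1) \_ (square a)) t + k%:E)%E.
have mpatch : measurable_fun setT ((EFin \o h1) \_ (square a)).
  apply/(measurable_restrictT _ _).1; first exact: measurable_square.
  by apply/measurable_EFinP; apply: measurable_funTS.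
have patch0 t : (0 <= ((EFin \o h1) \_ (square a)) t)%E.
  by rewrite patchE; case: ifP => // _; rewrite lee_fin.
apply: (@le_lt_trans _ _ (\int[mu2]_(t in angles R) g t)%E).
  apply: ge0_le_integral_patch.
  - by move=> t _; rewrite lee_fin.
  - by move=> t _; rewrite /g adde_ge0.
  move=> t; rewrite [leLHS]patchE [leRHS]patchE; case: ifPn => [/set_mem Dt|_]; last first.
    by case: ifP => // _; rewrite /g adde_ge0.
  rewrite ifT; last by rewrite inE; exact: Dang.
  have [->|/eqP t0] := eqVneq t (0, 0).
    apply: (@le_trans _ _ k%:E); first by rewrite lee_fin lerDr.
    by rewrite /g leeDr.
  rewrite fh1 // /g patchE; case: ifPn => [_|/negP ta]; first by rewrite leeDl.
  rewrite add0e lee_fin (@le_trans _ _ M) //.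
    by apply: hM => // sat; apply: ta; rewrite inE.
  by rewrite /k (le_trans (ler_norm M)) // lerDl.
rewrite ge0_integralD //; last 2 first.
- exact: measurable_angles.
- exact: measurable_funTS.
apply: lte_add_pinfty; last first.
  have -> : (\int[mu2]_(t in angles R) k%:E = k%:E * mu2 (angles R))%E.
    by apply: integral_cst; exact: measurable_angles.
  by rewrite lte_mul_pinfty ?angles_lty.
apply: le_lt_trans fin1; apply: ge0_le_integral_patch => //.
- by move=> t _; rewrite lee_fin.
by move=> t; rewrite [leLHS]patchE; case: ifP.
Qed.

Lemma square_angles (a : R) : a <= 1 -> square a `<=` angles R.
Proof.
move=> a1 t /squareP; rewrite !ler_norml => -[/andP[? ?] /andP[? ?]].
have := pi_ge2 R => ?; split; rewrite /= in_itv /=; apply/andP; split; lra.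
Qed.

Lemma ball11P (r : R) (z : C R * C R) :
  ball ((1, 1) : C R * C R) (r%:C) z <-> cmod (z.1 - 1) < r /\ cmod (z.2 - 1) < r.
Proof.
have E (v : C R) : ball (1 : C R) (r%:C) v <-> cmod (v - 1) < r.
  by rewrite -ball_normE /= distrC normE ltcR.
by case: z => z w; split=> [[/E ? /E ?]|[/E ? /E ?]].
Qed.

(** The angles near (1, 1) outside the open square of half-side a, by closed conditions only so as
    to be compact; for a > 0 the angle (0, 0) is left out. *)
Definition annular_box (r a : R) : set (R * R) :=
  [set t | [/\ `|t.1| <= pi, `|t.2| <= pi, cmod (expi t.1 - 1 : C R) <= r,
     cmod (expi t.2 - 1 : C R) <= r & a <= Num.max `|t.1| `|t.2|]].

Lemma annular_box_compact (r a : R) : compact (annular_box r a).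
Proof.
have cabs : continuous (fun x : R => `|x|) by exact: norm_continuous.
have cexp : continuous (fun x : R => cmod (expi x - 1 : C R)).
  have := @cmod_horner_expi_continuous R 'X 1.
  by under eq_fun do rewrite hornerX.
have cfst (f : R -> R) : continuous f -> continuous (fun t : R * R => f t.1).
  by move=> cf t; apply: (@continuous_comp _ _ _ fst f); [exact: cvg_fst|exact: cf].
have csnd (f : R -> R) : continuous f -> continuous (fun t : R * R => f t.2).
  by move=> cf t; apply: (@continuous_comp _ _ _ snd f); [exact: cvg_snd|exact: cf].
apply: (@subclosed_compact _ _ (`[- pi, pi] `*` `[- pi, pi])).
- rewrite (_ : annular_box r a =
    [set t : R * R | `|t.1| <= pi] `&` [set t : R * R | `|t.2| <= pi] `&`
    [set t : R * R | cmod (expi t.1 - 1 : C R) <= r] `&`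
    [set t : R * R | cmod (expi t.2 - 1 : C R) <= r] `&`
    [set t : R * R | a <= Num.max `|t.1| `|t.2|]); last first.
    by apply/seteqP; split=> t /=; [case|case=> [[[[? ?] ?] ?] ?]].
  have cle (f : R * R -> R) (k : R) : continuous f -> closed [set t | f t <= k].
    by move=> cf; apply: (@closed_comp _ _ f [set x | x <= k]) => //; exact: closed_le.
  have cge (f : R * R -> R) (k : R) : continuous f -> closed [set t | k <= f t].
    by move=> cf; apply: (@closed_comp _ _ f [set x | k <= x]) => //; exact: closed_ge.
  apply: closedI; [apply: closedI; [apply: closedI; [apply: closedI|]|]|].
  - exact/cle/cfst.
  - exact/cle/csnd.
  - exact/cle/(cfst (fun x => cmod (expi x - 1 : C R))).
  - exact/cle/(csnd (fun x => cmod (expi x - 1 : C R))).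
  - apply: cge => t.
    apply: (@continuous_max _ _ (fun t : R * R => `|t.1|) (fun t : R * R => `|t.2|) t).
      exact: (cfst (fun x => `|x|)).
    exact: (csnd (fun x => `|x|)).
- by apply: compact_setX; exact: segment_compact.
- by move=> t [t1 t2 _ _ _]; split; rewrite /= in_itv /= -ler_norml.
Qed.

Lemma dphi_eq0 p z w : p.[z, w] = 0 -> dphi p z w = 0.
Proof. by move=> pzw; rewrite /dphi pzw expr0n invr0 mulr0. Qed.

Lemma A1_stable_pair p : A1 p -> stable_pair p.
Proof.
move=> [_ pD pp _ _]; split=> // z w z1 w1; apply: (pD (z, w)).
by split; rewrite /= -norm_lt1.
Qed.

(** [E0] is so small that (1, 1) is the only possible zero of [p] in it. For each [E], a square of
    half-side 8 a lying over [E] carries the transfer in both directions, and off the smaller square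
    both derivatives are bounded. *)
Lemma partial_integral_local p : stable_pair p ->
  exists E0 : set (C R * C R),
    [/\ torus_open E0, E0 (1, 1) &
        forall s : R, 1 <= s ->
        forall E : set (C R * C R), torus_open E -> E `<=` E0 -> E (1, 1) ->
          ((torus_integral E (fun z : C R * C R => cmod (partial1 (phi p) z) `^ s)%R < +oo)%E
           <->
           (torus_integral E (fun z : C R * C R => cmod (partial2 (phi p) z) `^ s)%R < +oo)%E)].
Proof.
move=> sp; have sp' := stable_pair_swap sp.
have [r1 r10 H1] := torus_zeros_near sp; have [r2 r20 H2] := torus_zeros_near sp'.
pose r := Num.min r1 r2; have r0 : 0 < r by rewrite lt_min r10.
have rr1 : r <= r1 by rewrite ge_min lexx.
have rr2 : r <= r2 by rewrite ge_min lexx orbT.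
have p_neq0 (t : R * R) : `|t.1| <= pi -> `|t.2| <= pi -> t <> (0, 0) ->
    cmod (expi t.1 - 1 : C R) <= r -> cmod (expi t.2 - 1 : C R) <= r ->
    p.[expi t.1, expi t.2] != 0.
  case: t => x y /= xpi ypi t0 xr yr.
  (* If the second coordinate is not 1, its slice has no unimodular zero; otherwise the first one is
     not 1 and the swapped polynomial is used. *)
  have [y0|y0] := eqVneq y 0; last first.
    apply: H1 (norm_expi _) _ (le_trans yr rr1) _ (norm_expi _).
    by apply: contraNneq y0 => /expi_eq1 ->.
  rewrite -horner2_swapXY.
  apply: H2 (norm_expi _) _ (le_trans xr rr2) _ (norm_expi _).
  by apply/eqP => /expi_eq1 x0; apply: t0; rewrite x0 // y0.
pose E0 := (ball ((1, 1) : C R * C R) (r%:C))° `&` torus R.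
have rC0 : 0 < r%:C by rewrite ltcR.
exists E0; split.
- by exists ((ball ((1, 1) : C R * C R) (r%:C))°) => //; exact: open_interior.
- split; first exact: nbhsx_ballx.
  by split; apply/norm1_cmod; rewrite normr1.
move=> s s1 E [U oU EU] EE0 E11.
have s0 : s != 0 by rewrite gt_eqF // (lt_le_trans ltr01).
have U11 : U (1, 1) by move: E11; rewrite EU => -[].
have [e /= e0 eU] := (nbhs_ballP _ _).1 (open_nbhs_nbhs (conj oU U11)).
(* Radii of balls are positive elements of [C R], hence real. *)
have eE : e = (complex.Re e)%:C by rewrite RRe_real // ger0_real // ltW.
have re0 : 0 < complex.Re e by rewrite -ltcR -eE.
have [a1 a10 T1] := square_integral_transfer sp.
have [a2 a20 T2] := square_integral_transfer sp'.
(* The last bound gives 8 a < Re e, which puts the square of half-side 8 a over the ball contained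
   in [U]. *)
pose a := Num.min (Num.min a1 a2) (Num.min (1 / 8) (complex.Re e / 16)).
have a0 : 0 < a by rewrite !lt_min a10 a20 !divr_gt0.
have aa1 : a <= a1 by rewrite !ge_min lexx.
have aa2 : a <= a2 by rewrite !ge_min lexx !orbT.
have a8 : a <= 1 / 8 by rewrite !ge_min lexx !orbT.
have ae : a <= complex.Re e / 16 by rewrite !ge_min lexx !orbT.
pose D : set (mR * mR) := angles R `&` (@torus_point R @^-1` E).
have Dangles : D `<=` angles R by move=> t [].
have anglesP (t : R * R) : angles R t -> `|t.1| <= pi /\ `|t.2| <= pi.
  by move=> [] /=; rewrite !in_itv /= => /andP[? ?] /andP[? ?]; split; rewrite ler_norml ltW.
have DP t : D t -> [/\ `|t.1| <= pi, `|t.2| <= pi,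
    cmod (expi t.1 - 1 : C R) <= r & cmod (expi t.2 - 1 : C R) <= r].
  move=> [/anglesP[t1 t2] /EE0[/interior_subset/ball11P[/= ? ?] _]].
  by split=> //; apply: ltW.
have sqD : square (8 * a) `<=` D.
  move=> t ta; split; first by apply: square_angles ta; lra.
  have [t1 t2] := (squareP _ _).1 ta.
  rewrite /= EU; split; last by split; apply/norm1_cmod; exact: norm_expi.
  apply: eU; rewrite eE; apply/ball11P => /=.
  have := cmod_expiB1 t.1; have := cmod_expiB1 t.2; split; lra.
have D_neq0 t : D t -> t <> (0, 0) -> p.[expi t.1, expi t.2] != 0.
  by move=> /DP[? ? ? ?] ?; exact: p_neq0.
have outside t : D t -> ~ square a t -> annular_box r a t.
  move=> /DP[? ? ? ?] nta; split=> //; rewrite leNgt gt_max; apply/negP => /andP[ta1 ta2].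
  by apply: nta; apply/squareP; rewrite !ltW.
have box_neq0 t : annular_box r a t -> p.[expi t.1, expi t.2] != 0.
  move=> [? ? ? ? tmax]; apply: p_neq0 => // t0; move: tmax; rewrite t0 /= normr0 maxxx.
  by rewrite leNgt a0.
pose h1 := power p s.
pose h2 := (fun t => power (swapXY p) s (t.2, t.1)) : mR * mR -> R.
have mh1 : measurable_fun setT h1 by exact: measurable_power.
have mh2 : measurable_fun setT h2.
  exact: (measurableT_comp (measurable_power (swapXY p) s)
    (measurable_fun_pair measurable_snd measurable_fst)).
pose f1 := (fun t => cmod (partial1 (phi p) (torus_point t)) `^ s) : mR * mR -> R.
pose f2 := (fun t => cmod (partial2 (phi p) (torus_point t)) `^ s) : mR * mR -> R.
have fh1 (t : mR * mR) : p.[expi t.1, expi t.2] != 0 -> f1 t = h1 t.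
  by move=> pt; rewrite /f1 /h1 /power /torus_point partial1E.
have fh2 (t : mR * mR) : p.[expi t.1, expi t.2] != 0 -> f2 t = h2 t.
  by move=> pt; rewrite /f2 /h2 /power /torus_point partial2E.
have cmod0 : cmod (0 : C R) = 0 by apply/eqP; rewrite cmod_eq0.
(* At a zero of [p] the closed form is 0 to the power s, which is 0 because s is nonzero. *)
have hf1 t : h1 t <= f1 t.
  have [pt|/fh1->//] := eqVneq p.[expi t.1, expi t.2] 0.
  by rewrite /h1 /power dphi_eq0 // cmod0 powR0 // powR_ge0.
have hf2 t : h2 t <= f2 t.
  have [pt|/fh2->//] := eqVneq p.[expi t.1, expi t.2] 0.
  by rewrite /h2 /power dphi_eq0 ?horner2_swapXY // cmod0 powR0 // powR_ge0.
have s_ge0 : 0 <= s by apply: le_trans s1.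
have [M1 M10 b1] : exists2 M, 0 <= M & forall t, annular_box r a t -> h1 t <= M.
  have [M M0 HM] := dphi_bounded (annular_box_compact (r := r) (a := a)) box_neq0.
  exists (M `^ s); first exact: powR_ge0.
  by move=> t /HM ?; rewrite ge0_ler_powR ?nnegrE ?cmod_ge0.
have [M2 M20 b2] : exists2 M, 0 <= M & forall t, annular_box r a t -> h2 t <= M.
  have swap_box (t : R * R) : annular_box r a t -> annular_box r a (t.2, t.1).
    by move=> [? ? ? ? ?]; split=> //=; rewrite maxC.
  have [|M M0 HM] := @dphi_bounded R (swapXY p) _ (annular_box_compact (r := r) (a := a)).
    by move=> t /swap_box/box_neq0; rewrite horner2_swapXY.
  exists (M `^ s); first exact: powR_ge0.
  by move=> t /swap_box/HM ?; rewrite ge0_ler_powR ?nnegrE ?cmod_ge0.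
have sqa : square a `<=` angles R by apply: square_angles; lra.
have f10 t : 0 <= f1 t by exact: powR_ge0.
have f20 t : 0 <= f2 t by exact: powR_ge0.
have h10 t : 0 <= h1 t by exact: powR_ge0.
have h20 t : 0 <= h2 t by exact: powR_ge0.
have out1 t : D t -> ~ square a t -> h1 t <= M1.
  by move=> Dt ta; apply: b1; exact: outside.
have out2 t : D t -> ~ square a t -> h2 t <= M2.
  by move=> Dt ta; apply: b2; exact: outside.
have eq1 t : D t -> t <> (0, 0) -> f1 t = h1 t.
  by move=> Dt t0; apply: fh1; exact: D_neq0.
have eq2 t : D t -> t <> (0, 0) -> f2 t = h2 t.
  by move=> Dt t0; apply: fh2; exact: D_neq0.
have tr1 := T1 a s a0 aa1 s1.
have tr2 : (\int[mu2]_(t in square (8 * a)) (h1 t)%:E < +oo)%E ->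
    (\int[mu2]_(t in square a) (h2 t)%:E < +oo)%E.
  (* The transfer for the swapped polynomial has its coordinates exchanged; the squares are
     symmetric, so both integrals can be swapped back. *)
  move=> fin; rewrite (@integral_square_swap R _ (power (swapXY p) s)).
  - apply: (T2 a s a0 aa2 s1); rewrite swapXYK (@integral_square_swap R _ h1).
    + exact: fin.
    + exact: measurable_itv.
    + exact: mh1.
    + exact: h10.
  - exact: measurable_itv.
  - exact: measurable_power.
  - by move=> t; exact: powR_ge0.
split.
- exact: (square_integral_lty sqD Dangles sqa mh2 f20 f10 h20 h10 eq2
    (fun t _ => hf1 t) out2 tr2).
- exact: (square_integral_lty sqD Dangles sqa mh1 f10 f20 h10 h20 eq1
    (fun t _ => hf2 t) out1 tr1).
Qed.
End Localization.

Theorem corollary4p3 (R : realType) (p : {poly {poly C R}}) (hA1 : A1 p) :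
  exists E0 : set (C R * C R),
    [/\ torus_open E0, E0 (1, 1) &
        forall s : R, 1 <= s ->
        forall E : set (C R * C R), torus_open E -> E `<=` E0 -> E (1, 1) ->
          ((torus_integral E (fun z => cmod (partial1 (phi p) z) `^ s)%R < +oo)%E
           <->
           (torus_integral E (fun z => cmod (partial2 (phi p) z) `^ s)%R < +oo)%E)].
Proof. exact: partial_integral_local (A1_stable_pair hA1). Qed.
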